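(* Let $D$ be a Dirichlet–Ferguson process with parameter $\alpha$ on $(A,\mathcal{A})$. For every $N\ge0$, $$\mathcal{J}_N(D)=\mathcal{M}_N(D)\qquad\text{and}\qquad\bigoplus_{l=0}^N\mathcal{M}_l(D)=\mathcal{P}_N(D).$$
   Context: $(A,\mathcal{A})$ is a Polish space with its Borel $\sigma$-field and $\alpha$ is a finite positive measure on it ($0<\alpha(A)<\infty$). On a probability space $(\Omega,\mathcal{F},\mathbb{P})$, the Pólya sequence $\mathbf{X}=\{X_n:n\ge1\}$ with parameter $\alpha$ is a sequence of $A$-valued random variables such that, for every $k\ge1$ and $1\le j_1<\cdots<j_k$, $$\mathbb{P}(X_{j_1}\in da_1,\ldots,X_{j_k}\in da_k)=\prod_{i=1}^k\frac{\alpha(da_i)+\sum_{l=1}^{i-1}\delta_{a_l}(da_i)}{\alpha(A)+i-1}.$$ Write $\mathbf{X}_n=(X_1,\ldots,X_n)$. A Dirichlet–Ferguson process with parameter $\alpha$ is a random probability measure $D$ on $(A,\mathcal{A})$ such that for every finite measurable partition $(C_1,\ldots,C_n)$ of $A$ the vector $(D(C_1),\ldots,D(C_n))$ has a Dirichlet distribution with parameters $(\alpha(C_1),\ldots,\alpha(C_n))$. Standing convention: $D$ is the a.s. limit of the empirical measures $\frac1n\sum_{i=1}^n\mathbf{1}_C(X_i)$ of $\mathbf{X}$ (a.s. convergence for all $C\in\mathcal{A}$); then, conditionally on $D$, the $X_i$ are i.i.d. with law $D$. $L^2(D)$ is the Hilbert space of square-integrable random variables measurable with respect to $\sigma(D(C):C\in\mathcal{A})$;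 $D^{\otimes n}$ is the $n$-fold random product measure. $\Xi_n(\mathbf{X})$ is the class of symmetric measurable $h:A^n\to\mathbb{R}$ with $\mathbb{E}(h(\mathbf{X}_n)^2)<\infty$ and $\mathbb{E}(h(\mathbf{X}_n)\mid\mathbf{X}_{n-1})=0$ a.s. (for $n=1$: $\mathbb{E}(h(X_1))=0$). $\mathcal{M}_0(D)=\mathbb{R}$ and, for $n\ge1$, $\mathcal{M}_n(D)=\{Y\in L^2(D):Y=\int_{A^n}h\,\mathrm{d}D^{\otimes n},\ h\in\Xi_n(\mathbf{X})\}$; these are closed, mutually orthogonal subspaces of $L^2(D)$, and $\bigoplus$ denotes orthogonal sum in $L^2(D)$. $\mathcal{P}_0(D)=\mathbb{R}$ and, for $N\ge1$, $\mathcal{P}_N(D)$ is the closed linear span in $L^2(D)$ of the random variables $\prod_{j=1}^n(D(C_j))^{k_j}$ with $n\ge0$, $C_1,\ldots,C_n\in\mathcal{A}$, integers $k_j\ge1$ and $\sum_{j=1}^nk_j\le N$. $\mathcal{J}_0(D)=\mathbb{R}$ and, for $N\ge1$, $\mathcal{J}_N(D)=\mathcal{P}_N(D)\cap\mathcal{P}_{N-1}(D)^\perp$, the orthogonal complement being taken in $L^2(D)$. *)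

(* Defs.v *)
From HB Require Import structures.
From mathcomp Require Import all_boot all_order perm all_algebra.
From mathcomp Require Import all_classical all_reals all_analysis.
From mathcomp Require Import measurable_realfun.

Set Implicit Arguments.
Unset Strict Implicit.
Unset Printing Implicit Defensive.
Import Order.TTheory GRing.Theory Num.Theory.
Import numFieldNormedType.Exports.

Local Open Scope classical_set_scope.
Local Open Scope ring_scope.

Section polish_spaces.

Definition metric_on (R : realType) (T : Type) (dist : T -> T -> R) :=
  [/\ forall x y, 0 <= dist x y,
      forall x y, dist x y = 0 <-> x = y,
      forall x y, dist x y = dist y x &
      forall x y z, dist x z <= dist x y + dist y z].

Definition metrizes (R : realType) (T : topologicalType) (dist : T -> T -> R) :=
  forall (x : T) (U : set T),
    nbhs x U <-> exists2 e, 0 < e & [set y | dist x y < e] `<=` U.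

Definition complete_metric (R : realType) (T : topologicalType)
    (dist : T -> T -> R) :=
  forall u : nat -> T,
    (forall e, 0 < e -> exists N, forall m n,
       (N <= m)%N -> (N <= n)%N -> dist (u m) (u n) < e) ->
    exists l : T, u @ \oo --> l.

Definition separable (T : topologicalType) :=
  exists2 S : set T, countable S & dense S.

Definition polish (R : realType) (T : topologicalType) :=
  separable T /\
  exists dist : T -> T -> R,
    [/\ metric_on dist, metrizes dist & complete_metric dist].

Definition borel (T : ptopologicalType) : measurableType _ :=
  g_sigma_algebraType (@open T).

End polish_spaces.

Section product_probability.
Context d (T : measurableType d) (R : realType).

Definition cons_pair n (x : T * n.-tuple T) : n.+1.-tuple T :=
  [tuple of x.1 :: x.2].

Lemma measurable_cons_pair n : measurable_fun [set: _] (@cons_pair n).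
Proof. by apply: measurable_cons; [exact: measurable_fst|exact: measurable_snd]. Qed.

HB.instance Definition _ n :=
  isMeasurableFun.Build _ _ _ _ (@cons_pair n) (@measurable_cons_pair n).

Fixpoint tuple_prob n : ('I_n -> probability T R) ->
    probability (n.-tuple T) R :=
  match n with
  | 0 => fun=> \d_([tuple] : 0.-tuple T)
  | n.+1 => fun mu =>
      distribution ((mu ord0 \x tuple_prob (fun i => mu (lift ord0 i)))%E
                      : probability (T * n.-tuple T)%type R)
                   (@cons_pair n)
  end.

Definition prob_pow n (mu : probability T R) : probability (n.-tuple T) R :=
  tuple_prob (fun _ : 'I_n => mu).

End product_probability.

Section dirichlet_distribution.
Context (R : realType).

Definition gamma_density (a x : R) : R := x `^ (a - 1) * expR (- x).

Definition gamma_measure (a : R) (V : set R) : \bar R :=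
  (\int[lebesgue_measure]_(x in V) ((gamma_density a \_ `]0, +oo[) x)%:E)%E.

Lemma gamma_density_ge0 a x : 0 <= (gamma_density a \_ `]0, +oo[) x.
Proof.
by apply: restrict_ge0 => y _; rewrite mulr_ge0 ?powR_ge0 ?expR_ge0.
Qed.

Lemma measurable_gamma_density a :
  measurable_fun [set: R] (gamma_density a \_ `]0, +oo[).
Proof.
apply/measurable_restrict => //; apply: measurable_funTS.
apply: measurable_funM => //.
by apply: measurableT_comp => //; exact: measurable_expR.
Qed.

Section gamma_measure_instance.
Variable a : R.

Let gamma_measure0 : gamma_measure a set0 = 0%E.
Proof. by rewrite /gamma_measure integral_set0. Qed.

Let gamma_measure_ge0 V : (0 <= gamma_measure a V)%E.
Proof. by apply: integral_ge0 => x _; rewrite lee_fin gamma_density_ge0. Qed.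

Let gamma_measure_sigma_additive : semi_sigma_additive (gamma_measure a).
Proof.
move=> /= F mF tF mUF; rewrite /gamma_measure/= ge0_integral_bigcup//=.
- apply: is_cvg_ereal_nneg_natsum_cond => n _ _.
  by apply: integral_ge0 => x _; rewrite lee_fin gamma_density_ge0.
- apply: measurable_funTS; apply/measurable_EFinP.
  exact: measurable_gamma_density.
- by move=> x _; rewrite lee_fin gamma_density_ge0.
Qed.

HB.instance Definition _ := isMeasure.Build _ _ _ (gamma_measure a)
  gamma_measure0 gamma_measure_ge0 gamma_measure_sigma_additive.

End gamma_measure_instance.

(* Gamma(a, 1) law for a >= 0, degenerate at 0 when a = 0.  For a > 0 the total
   mass of [gamma_measure a] is Euler's Gamma(a), finite and positive, so the
   default value \d_0 of [mnormalize] is never used. *)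
Definition gamma_prob (a : R) : probability R R :=
  if a == 0 then \d_(0 : R) : probability R R
  else mnormalize (gamma_measure a) (\d_(0 : R)) : probability R R.

Definition normalize n (t : n.-tuple R) : n.-tuple R :=
  [tuple tnth t i / \sum_(j < n) tnth t j | i < n].

(* Law of (Z_1, ..., Z_n) / (Z_1 + ... + Z_n) for independent Z_i ~ Gamma(a_i, 1);
   this covers parameters some (but not all) of which vanish. *)
Definition dirichlet n (a : 'I_n -> R) :
    set (n.-tuple R) -> \bar R :=
  pushforward (tuple_prob (fun i => gamma_prob (a i))) (@normalize n).

End dirichlet_distribution.

Section polya.
Context d (A : measurableType d) (R : realType) (alpha : set A -> \bar R).

(* Law of the next draw after the draws [s]. *)
Definition polya_predictive (s : seq A) (B : set A) : \bar R :=
  ((alpha B + \sum_(a <- s) \d_a B) *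
   ((fine (alpha [set: A]) + (size s)%:R)^-1)%:E)%E.

(* The iterated integral, over B_1, B_2, ... successively, of the predictive
   laws: the measure of the rectangle B_1 x ... x B_k, given previous draws [s]. *)
Fixpoint polya_law (s : seq A) (Bs : seq (set A)) : \bar R :=
  match Bs with
  | [::] => 1%E
  | B :: Bs' =>
      (\int[polya_predictive s]_(a in B) polya_law (rcons s a) Bs')%E
  end.

End polya.

Section setting.
Context (R : realType) d (A : measurableType d)
  (alpha : {finite_measure set A -> \bar R})
  d' (Omega : measurableType d') (P : probability Omega R)
  (X : nat -> {RV P >-> A}) (D : {RV P >-> pprobability A R}).

(* The sequence is indexed from 0: [X i] is the (i+1)-st draw. *)
Definition polya_sequence :=
  forall (k : nat) (j : 'I_k -> nat) (B : 'I_k -> set A),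
    (0 < k)%N ->
    (forall i i' : 'I_k, (i < i')%N -> (j i < j i')%N) ->
    (forall i, measurable (B i)) ->
    P (\bigcap_(i : 'I_k) (X (j i) @^-1` B i)) =
      polya_law alpha [::] [seq B i | i : 'I_k].

Definition draws n (w : Omega) : n.-tuple A := [tuple X i w | i < n].

Definition Dprob (w : Omega) : probability A R := D w.

Definition Dval (C : set A) (w : Omega) : R := fine (Dprob w C).

Definition dirichlet_ferguson :=
  forall (n : nat) (C : 'I_n -> set A),
    (forall i, measurable (C i)) ->
    trivIset [set: 'I_n] C ->
    \bigcup_(i : 'I_n) C i = [set: A] ->
    forall B : set (n.-tuple R), measurable B ->
      P [set w | B [tuple Dval (C i) w | i < n]] =
        dirichlet (fun i => fine (alpha (C i))) B.

Definition empirical_limit :=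
  forall C : set A, measurable C ->
    {ae P, forall w,
      (fun n => (\sum_(i < n) \1_C (X i w)) / n%:R) @ \oo --> Dval C w}.

Definition sigmaD : set (set Omega) :=
  <<s \bigcup_(C in @measurable _ A)
        preimage_set_system [set: Omega] (Dval C) measurable >>.

Definition measurable_wrt (G : set (set Omega)) (Y : Omega -> R) :=
  forall B : set R, measurable B -> G (Y @^-1` B).

(* Elements of L^2(D) are represented by functions.  All the subspaces below are
   stable under almost sure equality within L2D, so that equality of such sets of
   functions is equality of the corresponding subspaces of L^2(D). *)
Definition L2D : set (Omega -> R) :=
  [set Y | measurable_wrt sigmaD Y /\ ('E_P[fun w => (Y w ^+ 2)%R] < +oo)%E].

Definition is_cond_exp (G : set (set Omega)) (Z W : Omega -> R) :=
  [/\ measurable_wrt G W, P.-integrable [set: Omega] (EFin \o W) &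
      forall B, G B ->
        (\int[P]_(w in B) (W w)%:E = \int[P]_(w in B) (Z w)%:E)%E].

Definition symmetric_fun n (h : n.-tuple A -> R) :=
  forall (s : 'S_n) (t : n.-tuple A), h [tuple tnth t (s i) | i < n] = h t.

(* For n = 1 the conditioning sigma-field is that of the empty tuple, i.e.
   {set0, setT}, and the last condition reads E(h(X_1)) = 0. *)
Definition Xi n : set (n.-tuple A -> R) :=
  [set h | [/\ measurable_fun [set: n.-tuple A] h,
               symmetric_fun h,
               ('E_P[fun w => (h (draws n w) ^+ 2)%R] < +oo)%E &
               is_cond_exp (g_sigma_algebra_preimage (draws n.-1))
                 (fun w => h (draws n w)) (cst 0)]].

Definition constants : set (Omega -> R) :=
  [set Y | L2D Y /\ exists c : R, {ae P, forall w, Y w = c}].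

Definition Mspace n : set (Omega -> R) :=
  if n is 0 then constants else
  [set Y | L2D Y /\ exists2 h : n.-tuple A -> R, Xi h &
     {ae P, forall w, (Y w)%:E = \int[prob_pow n (Dprob w)]_t (h t)%:E}%E].

Definition monomials N : set (Omega -> R) :=
  [set Y | exists (n : nat) (C : 'I_n -> set A) (k : 'I_n -> nat),
     [/\ forall j, measurable (C j), forall j, (1 <= k j)%N,
         (\sum_(j < n) k j <= N)%N &
         Y = fun w => \prod_(j < n) Dval (C j) w ^+ k j]].

Definition lin_span (S : set (Omega -> R)) : set (Omega -> R) :=
  [set Y | exists (m : nat) (c : 'I_m -> R) (Z : 'I_m -> Omega -> R),
     (forall i, S (Z i)) /\ Y = fun w => \sum_(i < m) c i * Z i w].

Definition L2D_closure (S : set (Omega -> R)) : set (Omega -> R) :=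
  [set Y | L2D Y /\ forall e : R, 0 < e ->
     exists2 Z, S Z & (Lnorm P 2%:E (EFin \o (Y \- Z)%R) < e%:E)%E].

Definition Pspace N : set (Omega -> R) :=
  if N is 0 then constants else L2D_closure (lin_span (monomials N)).

Definition orthogonal (Y Z : Omega -> R) := ('E_P[fun w => (Y w * Z w)%R] = 0)%E.

Definition L2D_orthocomplement (S : set (Omega -> R)) : set (Omega -> R) :=
  [set Y | L2D Y /\ forall Z, S Z -> orthogonal Y Z].

Definition Jspace N : set (Omega -> R) :=
  if N is N'.+1 then Pspace N `&` L2D_orthocomplement (Pspace N')
  else constants.

(* [V] is the orthogonal direct sum of V_0, ..., V_N. *)
Definition is_orthogonal_sum N (Vs : nat -> set (Omega -> R))
    (V : set (Omega -> R)) :=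
  (forall l m, (l <= N)%N -> (m <= N)%N -> l <> m ->
     forall Y Z, Vs l Y -> Vs m Z -> orthogonal Y Z) /\
  V = [set Y | L2D Y /\ exists2 Z : 'I_N.+1 -> Omega -> R,
         (forall l : 'I_N.+1, Vs l (Z l)) &
         {ae P, forall w, Y w = \sum_(l < N.+1) Z l w}].

End setting.

(* Main.v *)
(** Given [D], the draws are i.i.d. with law [D]; this is obtained from the urn by
    replacing each factor [D(C)] by averages of indicators over later and later
    disjoint blocks of draws.  Write c(n, m) for the probability that, after [n]
    distinct draws, the next [m] draws copy [m] different ones of them.
    Expanding the urn rule shows that for a monomial [Z] of degree [m <= n] in the
    [D(C)], E[Z | X_1, ..., X_n] is a combination of indicators of rectangles
    constraining at most [m] coordinates, and that S_n Z = E[E[Z | X_1, ..., X_n] | D]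
    equals c(n, m) Z up to monomials of lower degree, with c(n, m) > 0.

    If [h] is degenerate and symmetric in [N] variables, its integral is orthogonal
    to any monomial of degree less than [N], because the posterior mean of the latter
    constrains at most [N - 1] draws; so M_N is contained in J_N.  Conversely S_N
    acts on J_N as multiplication by c(N, N), hence [Y] in J_N is the integral of
    E[Y | X_1, ..., X_N] / c(N, N), and this function is degenerate because [Y] is
    orthogonal to P_{N-1}.  The decomposition of P_N follows by induction on [N]. *)

Require Import Defs.
From HB Require Import structures.
From mathcomp Require Import all_boot all_order perm all_algebra.
From mathcomp Require Import ring lra.
From mathcomp Require Import all_classical all_reals all_analysis.
From mathcomp Require Import measurable_realfun giry.
Set Implicit Arguments.
Unset Strict Implicit.
Unset Printing Implicit Defensive.
Import Order.TTheory GRing.Theory Num.Theory.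
Import numFieldNormedType.Exports.
Local Open Scope classical_set_scope.
Local Open Scope ring_scope.

(** * Square-integrable functions *)

(** All comparisons are made weakly. Conditional expectation given [D] is replaced by
    [sample_mean D g], the integral of [g] against a power of [D], which is known only through its
    pairings with monomials. This suffices because an element of [Dpoly_cl N] orthogonal to all
    monomials of degree at most [N] vanishes almost surely. Likewise the conditional expectation
    given n draws is a function [g] on tuples, tested against indicators of rectangles. If Z is a
    monomial with posterior mean u(X), the chain <T g, Z> = <g(X), Z> = <g(X), u(X)> = <Y, u(X)> =
    <Y, T u> moves the operator S_n from Y to Z. So the expansion is needed for monomials only,
    never for elements of a closure. The factors of c(n, m) are (n - i) / (theta + n + i) for i < m:
    of the mass theta + n + i in the urn, n - i units are draws not yet copied. With n < m one
    factor is 0, so degree N takes at least N draws; with exactly N draws the sample means stay in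
    degree N. *)

Section square_integrable.
Context d (T : measurableType d) (R : realType) (mu : probability T R).
Implicit Types f g h : T -> R.

Definition rint f := mu.-integrable [set: T] (EFin \o f).

Definition L2 : set (T -> R) :=
  [set f : T -> R | measurable_fun [set: T] f /\ rint (fun x => f x ^+ 2)].

Definition ip f g := \int[mu]_x (f x * g x).

Lemma rint_le f g : measurable_fun [set: T] f -> rint g ->
  (forall x, `|f x| <= `|g x|) -> rint f.
Proof.
move=> mf ig fg; apply: (le_integrable measurableT _ _ ig).
  exact/measurable_EFinP.
by move=> x _ /=; rewrite lee_fin.
Qed.

Lemma rint_measurable f : rint f -> measurable_fun [set: T] f.
Proof. by move=> /measurable_int/measurable_EFinP. Qed.

Lemma rintZD a f g : rint f -> rint g -> rint (fun x => a * f x + g x).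
Proof.
move=> fi gi; rewrite /rint (_ : EFin \o _ =
  ((fun x => a%:E * (EFin \o f) x) \+ (EFin \o g))%E).
  by apply: integrableD => //; exact: integrableZl.
by apply/funext => x /=; rewrite EFinD EFinM.
Qed.

Lemma rint_cst c : rint (cst c).
Proof. exact: finite_measure_integrable_cst. Qed.

Lemma rintD f g : rint f -> rint g -> rint (fun x => f x + g x).
Proof.
by move=> fi gi; have := rintZD 1 fi gi; under eq_fun do rewrite mul1r.
Qed.

Lemma rintZ a f : rint f -> rint (fun x => a * f x).
Proof.
by move=> fi; have := rintZD a fi (rint_cst 0); under eq_fun do rewrite addr0.
Qed.

Lemma Rint_ZD a f g : rint f -> rint g ->
  \int[mu]_x (a * f x + g x) = a * \int[mu]_x f x + \int[mu]_x g x.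
Proof.
move=> fi gi; rewrite RintegralD//; first by rewrite RintegralZl.
exact: rintZ.
Qed.

Lemma Rint_cst c : \int[mu]_x c = c.
Proof. by rewrite Rintegral_cst// [X in fine X](@probability_setT _ _ _ mu) mulr1. Qed.

Lemma Rint_ge0 f : (forall x, 0 <= f x) -> 0 <= \int[mu]_x f x.
Proof. by move=> f0; apply: Rintegral_ge0. Qed.

Lemma Rint_sum (I : Type) (s : seq I) (F : I -> T -> R) :
  (forall i, rint (F i)) ->
  rint (fun x => \sum_(i <- s) F i x) /\
  \int[mu]_x (\sum_(i <- s) F i x) = \sum_(i <- s) \int[mu]_x F i x.
Proof.
move=> iF; elim: s => [|i s [IH1 IH2]].
  rewrite (_ : (fun x => \sum_(i <- [::]) F i x) = cst 0); last first.
    by apply/funext => x; rewrite big_nil.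
  by rewrite big_nil Rint_cst; split => //; exact: rint_cst.
rewrite (_ : (fun x => \sum_(j <- i :: s) F j x) =
    (fun x => 1 * F i x + \sum_(j <- s) F j x)); last first.
  by apply/funext => x; rewrite big_cons mul1r.
by split; [exact: rintZD | rewrite Rint_ZD// IH2 mul1r big_cons].
Qed.

Lemma rint_bounded f M : measurable_fun [set: T] f ->
  (forall x, `|f x| <= M) -> rint f.
Proof.
move=> mf fM; apply: (rint_le mf (rint_cst M)) => x /=.
by rewrite (le_trans (fM x)) ?ler_norm.
Qed.

Lemma Rint_indic A : measurable A -> \int[mu]_x (\1_A x) = fine (mu A).
Proof. by move=> mA; rewrite /Rintegral integral_indic// setIT. Qed.

Lemma Rint_dct (F : nat -> T -> R) f G :
  (forall k, measurable_fun [set: T] (F k)) -> measurable_fun [set: T] f ->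
  {ae mu, forall x, (F k x) @[k --> \oo] --> f x} -> rint G ->
  {ae mu, forall x, forall k, `|F k x| <= G x} ->
  rint f /\ (\int[mu]_x F k x) @[k --> \oo] --> \int[mu]_x f x.
Proof.
move=> mF mf Ff iG FG.
have [|||||fi _ cv] := @dominated_convergence _ _ _ mu _ measurableT
  (fun k => EFin \o F k) (EFin \o f) (EFin \o G).
- by move=> k; exact/measurable_EFinP.
- exact/measurable_EFinP.
- apply: filterS Ff => x Fx _; apply: cvg_EFin; first exact: nearW.
  exact: Fx.
- exact: iG.
- by apply: filterS FG => x Fx k _ /=; rewrite lee_fin; exact: Fx.
split => //; rewrite /Rintegral.
apply: fine_cvg; rewrite fineK//.
exact: integrable_fin_num.
Qed.

Lemma L2_le f g : L2 f -> measurable_fun [set: T] g ->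
  (forall x, `|g x| <= `|f x|) -> L2 g.
Proof.
move=> [mf fi] mg gf; split=> //; apply: (rint_le _ fi).
  exact: measurable_funX.
by move=> x; rewrite !normrX ler_sqr ?nnegrE.
Qed.

Lemma L2_cst c : L2 (cst c).
Proof. by split=> //; exact: (rint_cst (c ^+ 2)). Qed.

Lemma L2_bounded f M : measurable_fun [set: T] f ->
  (forall x, `|f x| <= M) -> L2 f.
Proof.
move=> mf fM; apply: (L2_le (L2_cst M) mf) => x.
by rewrite (le_trans (fM x)) ?ler_norm.
Qed.

Lemma L2_indic B : measurable B -> L2 (\1_B).
Proof.
move=> mB; apply: (@L2_bounded _ 1); first exact: measurable_indic.
by move=> x; rewrite indicE ger0_norm// lern1 leq_b1.
Qed.

Lemma L2M f g : L2 f -> L2 g -> rint (fun x => f x * g x).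
Proof.
move=> [mf fi] [mg gi]; apply: (rint_le _ (rintD fi gi)).
  exact: measurable_funM.
move=> x; rewrite [leRHS]ger0_norm ?addr_ge0 ?sqr_ge0// ler_norml.
by apply/andP; split; nra.
Qed.

Lemma L2ZD a f g : L2 f -> L2 g -> L2 (fun x => a * f x + g x).
Proof.
move=> f2 g2; split.
  by apply: measurable_funD; [apply: measurable_funM => //; exact: f2.1|exact: g2.1].
have := rintZD (a ^+ 2) f2.2 (rintZD (2 * a) (L2M f2 g2) g2.2).
by congr rint; apply/funext => x; ring.
Qed.

Lemma L2_add f g : L2 f -> L2 g -> L2 (fun x => f x + g x).
Proof.
by move=> fi gi; have := L2ZD 1 fi gi; under eq_fun do rewrite mul1r.
Qed.

Lemma L2Z a f : L2 f -> L2 (fun x => a * f x).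
Proof.
by move=> fi; have := L2ZD a fi (L2_cst 0); under eq_fun do rewrite addr0.
Qed.

Lemma L2B f g : L2 f -> L2 g -> L2 (fun x => f x - g x).
Proof.
move=> fi gi; have := L2ZD (-1) gi fi.
by under eq_fun do rewrite mulN1r addrC.
Qed.

Lemma L2_sum (I : Type) (s : seq I) (F : I -> T -> R) :
  (forall i, L2 (F i)) -> L2 (fun x => \sum_(i <- s) F i x).
Proof.
move=> iF; elim: s => [|i s IH].
  by rewrite (_ : (fun x => _) = cst 0);
    [exact: L2_cst | apply/funext => x; rewrite big_nil].
rewrite (_ : (fun x => _) = (fun x => F i x + \sum_(j <- s) F j x)).
  exact: L2_add.
by apply/funext => x; rewrite big_cons.
Qed.

Lemma L2_rint f : L2 f -> rint f.
Proof.
move=> f2; have := L2M f2 (L2_cst 1).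
by under eq_fun do rewrite mulr1.
Qed.

Lemma L2E f : measurable_fun [set: T] f ->
  L2 f <-> ('E_mu[fun x => (f x ^+ 2)%R] < +oo)%E.
Proof.
move=> mf; rewrite unlock; split=> [[_ /integrableP[_]]|fo].
  by under eq_integral do rewrite /= ger0_norm ?sqr_ge0//.
split=> //; apply/integrableP; split.
  by apply/measurable_EFinP; exact: measurable_funX.
by under eq_integral do rewrite /= ger0_norm ?sqr_ge0//.
Qed.

Lemma ipC f g : ip f g = ip g f.
Proof. by rewrite /ip; under eq_Rintegral do rewrite mulrC. Qed.

Lemma ipZD a f g h : L2 f -> L2 g -> L2 h ->
  ip (fun x => a * f x + g x) h = a * ip f h + ip g h.
Proof.
move=> f2 g2 h2; rewrite /ip -Rint_ZD; try exact: L2M.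
by under eq_Rintegral do rewrite mulrDl -mulrA.
Qed.

Lemma ip0r f : ip f (cst 0) = 0.
Proof. by rewrite /ip; under eq_Rintegral do rewrite mulr0; exact: Rint_cst. Qed.

Lemma ipZl a f g : L2 f -> L2 g -> ip (fun x => a * f x) g = a * ip f g.
Proof.
move=> f2 g2; rewrite /ip -RintegralZl//; last exact: L2M.
by apply: eq_Rintegral => x _; rewrite mulrA.
Qed.

Lemma ipD f g h : L2 f -> L2 g -> L2 h ->
  ip (fun x => f x + g x) h = ip f h + ip g h.
Proof.
by move=> f2 g2 h2; have := ipZD 1 f2 g2 h2; under eq_fun do rewrite mul1r;
  rewrite mul1r.
Qed.

Lemma ipB f g h : L2 f -> L2 g -> L2 h ->
  ip (fun x => f x - g x) h = ip f h - ip g h.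
Proof.
move=> f2 g2 h2; have := ipZD (-1) g2 f2 h2.
by under eq_fun do rewrite mulN1r addrC; rewrite mulN1r addrC.
Qed.

Lemma ip_sum (I : Type) (s : seq I) (F : I -> T -> R) h :
  (forall i, L2 (F i)) -> L2 h ->
  ip (fun x => \sum_(i <- s) F i x) h = \sum_(i <- s) ip (F i) h.
Proof.
move=> F2 h2; rewrite /ip.
under eq_Rintegral do rewrite mulr_suml.
by apply: (proj2 (@Rint_sum _ s (fun i x => F i x * h x) _)) => i; exact: L2M.
Qed.

Lemma ip_ge0 f : 0 <= ip f f.
Proof. by apply: Rint_ge0 => x; rewrite -expr2 sqr_ge0. Qed.

(** The quadratic function t -> ip (t f + g) (t f + g) is nonnegative, and t = - ip f g / ip f f is
    its minimum. If [ip f f] vanishes the function is affine; were its slope nonzero, the chosen [t]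
    would give the value -1. *)
Lemma ip_CS f g : L2 f -> L2 g -> ip f g ^+ 2 <= ip f f * ip g g.
Proof.
move=> f2 g2.
have H t : 0 <= t ^+ 2 * ip f f + (2 * t) * ip f g + ip g g.
  have := ip_ge0 (fun x => t * f x + g x).
  rewrite ipZD//; last exact: L2ZD.
  rewrite (ipC f) (ipC g) !ipZD// (ipC g f).
  by rewrite (_ : t * _ + _ = t ^+ 2 * ip f f + 2 * t * ip f g + ip g g)//; ring.
have [f0|f0] := eqVneq (ip f f) 0.
  rewrite f0 mul0r.
  have [->|fg0] := eqVneq (ip f g) 0; first by rewrite expr0n.
  have := H (- (ip g g + 1) / (2 * ip f g)).
  have -> : 2 * (- (ip g g + 1) / (2 * ip f g)) * ip f g = - (ip g g + 1).
    by field.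
  by rewrite f0 mulr0 add0r; lra.
have fp : 0 < ip f f by rewrite lt_neqAle eq_sym f0 ip_ge0.
have := H (- ip f g / ip f f).
have -> : (- ip f g / ip f f) ^+ 2 * ip f f + 2 * (- ip f g / ip f f) * ip f g +
  ip g g = (ip f f * ip g g - ip f g ^+ 2) / ip f f by field.
by rewrite pmulr_lge0 ?invr_gt0// subr_ge0.
Qed.

Lemma ip_eq0_ae f : L2 f -> ip f f = 0 -> {ae mu, forall x, f x = 0}.
Proof.
move=> f2; rewrite /ip /Rintegral => f0.
have : (\int[mu]_x `|(f x * f x)%:E| = 0)%E.
  under eq_integral do rewrite /= -expr2 ger0_norm ?sqr_ge0// expr2.
  rewrite -[RHS]/(0%:E) -f0 fineK//.
  exact: (integrable_fin_num _ (L2M f2 f2)).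
move/ae_eq_integral_abs => /(_ measurableT).
have mff : measurable_fun [set: T] (fun x => (f x * f x)%:E).
  by apply/measurable_EFinP; apply: measurable_funM; exact: f2.1.
move=> /(_ mff) ae0; apply: filterS ae0 => x /(_ I) /= [/eqP].
by rewrite mulf_eq0 orbb => /eqP.
Qed.

Lemma eq_ae_ip f f' g : L2 f -> L2 f' -> L2 g ->
  {ae mu, forall x, f x = f' x} -> ip f g = ip f' g.
Proof.
move=> f2 f2' g2 ff; congr fine; apply: ae_eq_integral => //.
- by apply/measurable_EFinP; apply: measurable_funM; [exact: f2.1|exact: g2.1].
- by apply/measurable_EFinP; apply: measurable_funM; [exact: f2'.1|exact: g2.1].
- by apply: filterS ff => x -> _.
Qed.

Lemma ip_add_le f g : L2 f -> L2 g ->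
  ip (fun x => f x + g x) (fun x => f x + g x) <= 2 * ip f f + 2 * ip g g.
Proof.
move=> f2 g2; have := ip_ge0 (fun x => f x - g x).
rewrite !ipB ?ipD//; try exact: L2B; try exact: L2_add.
rewrite !(ipC _ (fun x => f x + g x)) !(ipC _ (fun x => f x - g x)).
rewrite !ipB ?ipD// (ipC g f); lra.
Qed.

(** Each term of [ip_add_le] contributes at most e / 2; the [+ 1] keeps the denominator nonzero when
    [a] is 0. This is the linearity step of both approximation arguments, by step functions and by
    polynomials. *)
Lemma ipZD_lt a f g e : L2 f -> L2 g -> 0 < e ->
  ip f f < e / (4 * (a ^+ 2 + 1)) -> ip g g < e / 4 ->
  ip (fun x => a * f x + g x) (fun x => a * f x + g x) < e.
Proof.
move=> f2 g2 e0 fe ge; apply: (le_lt_trans (ip_add_le (L2Z a f2) g2)).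
rewrite ipZl//; last exact: L2Z.
rewrite ipC ipZl// mulrA -expr2.
have fa : a ^+ 2 * ip f f <= e / 4.
  apply: (@le_trans _ _ ((a ^+ 2 + 1) * (e / (4 * (a ^+ 2 + 1))))).
    by rewrite ler_pM ?sqr_ge0 ?ip_ge0 ?(ltW fe)// lerDl.
  rewrite le_eqVlt; apply/orP; left; apply/eqP; field.
  by apply: lt0r_neq0; rewrite ltr_wpDl ?sqr_ge0.
lra.
Qed.

Lemma ip_dct (F : nat -> T -> R) f g :
  (forall k, measurable_fun [set: T] (F k)) -> L2 f -> L2 g ->
  (forall x, (F k x) @[k --> \oo] --> f x) ->
  (forall k x, `|F k x| <= `|f x|) ->
  (ip (F k) g) @[k --> \oo] --> ip f g.
Proof.
move=> mF f2 g2 Ff Fle; rewrite /ip.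
have [||||//|_] := @Rint_dct (fun k x => F k x * g x) (fun x => f x * g x)
    (fun x => `|f x * g x|).
- by move=> k; apply: measurable_funM => //; exact: g2.1.
- by apply: measurable_funM; [exact: f2.1|exact: g2.1].
- apply: aeW => x; apply: cvgM; [exact: Ff|exact: cvg_cst].
- exact: (integrable_norm (L2M f2 g2)).
- by apply: aeW => x k; rewrite !normrM ler_wpM2r.
exact.
Qed.

Lemma ip_dct0 (F : nat -> T -> R) f :
  (forall k, measurable_fun [set: T] (F k)) -> L2 f ->
  (forall x, (F k x) @[k --> \oo] --> f x) ->
  (forall k x, `|F k x| <= `|f x|) ->
  (ip (fun x => f x - F k x) (fun x => f x - F k x)) @[k --> \oo] --> (0 : R).
Proof.
move=> mF f2 Ff Fle; rewrite /ip.
have [||||//|_] := @Rint_dct (fun k x => (f x - F k x) * (f x - F k x)) (cst 0)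
    (fun x => 4 * f x ^+ 2).
- by move=> k; apply: measurable_funM; apply: measurable_funB => //; exact: f2.1.
- exact: measurable_cst.
- apply: aeW => x; rewrite (_ : cst 0 x = (f x - f x) * (f x - f x)); last first.
    by rewrite subrr mulr0.
  by apply: cvgM; (apply: cvgB; [exact: cvg_cst|exact: Ff]).
- by apply: rintZ; exact: f2.2.
- apply: aeW => x k; rewrite -expr2 normrX.
  have -> : 4 * f x ^+ 2 = (2 * `|f x|) ^+ 2 by rewrite exprMn real_normK ?num_real//; ring.
  rewrite ler_sqr ?nnegrE ?mulr_ge0//.
  by rewrite (le_trans (ler_normB _ _))// mulr_natl mulr2n lerD.
by rewrite Rint_cst.
Qed.

End square_integrable.

(** * Monotone classes and density of step functions *)

Section monotone_class.
Import HBNNSimple.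
Context d (T : measurableType d) (R : realType).

(* Functional monotone class theorem; the domination [|F k| <= |f|] in the
   passage to the limit makes it usable both for bounded and for
   square-integrable functions. *)
Lemma functional_monotone_class (G : set (set T)) (L H : set (T -> R)) :
  measurable = <<s G >> -> setI_closed G -> G [set: T] ->
  (forall c, L (cst c)) ->
  (forall f g : T -> R, L f -> measurable_fun [set: T] g ->
     (forall x, `|g x| <= `|f x|) -> L g) ->
  (forall B, G B -> H (\1_B)) ->
  (forall a (f g : T -> R), measurable_fun [set: T] f -> measurable_fun [set: T] g ->
     L f -> L g -> H f -> H g -> H (fun x => a * f x + g x)) ->
  (forall (F : nat -> T -> R) (f : T -> R),
     (forall k, measurable_fun [set: T] (F k)) -> (forall k, H (F k)) ->
     measurable_fun [set: T] f -> L f ->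
     (forall k x, `|F k x| <= `|f x|) ->
     (forall x, F k x @[k --> \oo] --> f x) -> H f) ->
  forall f : T -> R, measurable_fun [set: T] f -> L f -> H f.
Proof.
move=> mG GI GT Lc Lle HG Hlin Hlim.
have Lb (f : T -> R) (M : R) : measurable_fun [set: T] f -> (forall x, `|f x| <= M) -> L f.
  move=> mf fM; apply: (Lle (cst M)) => // x /=.
  by rewrite (le_trans (fM x)) ?ler_norm.
have Li (B : set T) : measurable B -> L (\1_B).
  move=> mB; apply: (Lb _ 1); first exact: measurable_indic.
  by move=> x; rewrite indicE ger0_norm// lern1 leq_b1.
(* [H] is only assumed stable under combinations, so 0 is obtained as - 1 + 1 on the whole space. *)
have H0 : H (cst 0).
  have -> : cst 0 = (fun x => (-1) * (\1_[set: T] x) + \1_[set: T] x) :> (T -> R).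
    by apply/funext => x /=; rewrite mulN1r addNr.
  by apply: Hlin; try exact: measurable_indic; try exact: Li; exact: HG.
(* The sets whose indicator lies in [H] form a lambda-system: proper differences come from [Hlin],
   increasing unions from [Hlim]. *)
have Hi (B : set T) : measurable B -> H (\1_B).
  suff : <<s G >> `<=` [set B | measurable B /\ H (\1_B)].
    by move=> sub mB; apply: (sub B _).2; rewrite -mG.
  apply: lambda_system_subset => //; last first.
  - by move=> C GC; split; [rewrite mG; exact: sub_sigma_algebra|exact: HG].
  split=> //.
  - by split; [|exact: HG].
  - move=> A C CA [mA HA] [mC HC]; split; first exact: measurableD.
    have -> : \1_(A `\` C) = (fun x => (-1) * \1_C x + \1_A x) :> (T -> R).
      apply/funext => x; rewrite !indicE in_setD.
      have [xC|xC] := boolP (x \in C).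
        by rewrite (mem_set (CA _ (set_mem xC))) andbF mulN1r addNr.
      by rewrite andbT mulr0 add0r.
    by apply: Hlin; try exact: measurable_indic; try exact: Li.
  - move=> F ndF HF.
    have mF k : measurable (F k) by exact: (HF k).1.
    have mU : measurable (\bigcup_n F n) by exact: bigcup_measurable.
    split=> //; apply: (Hlim (fun k => \1_(F k))).
    + by move=> k; exact: measurable_indic.
    + by move=> k; exact: (HF k).2.
    + exact: measurable_indic.
    + exact: Li.
    + move=> k x; rewrite !indicE !ger0_norm// ler_nat.
      have [xF|//] := boolP (x \in F k).
      by rewrite mem_set//; exists k => //; exact: set_mem.
    + move=> x; have [[k _ Fkx]|nx] := pselect ((\bigcup_n F n) x).
        apply: cvg_near_cst; exists k => // m /= km.
        rewrite !indicE mem_set; last first.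
          by have /subsetPset := ndF _ _ km; exact.
        by rewrite mem_set//; exists k.
      apply: cvg_near_cst; apply: nearW => m.
      by rewrite !indicE !memNset// => Fm; apply: nx; exists m.
have Hsum (I : choiceType) (s : seq I) (c : I -> R) (B : I -> set T) :
    (forall i, measurable (B i)) ->
    measurable_fun [set: T] (fun x => \sum_(i <- s) c i * \1_(B i) x) /\
    L (fun x => \sum_(i <- s) c i * \1_(B i) x) /\
    H (fun x => \sum_(i <- s) c i * \1_(B i) x).
  move=> mB.
  have ms r : measurable_fun [set: T] (fun x => \sum_(i <- r) c i * \1_(B i) x).
    apply: measurable_sum => i; apply: measurable_funM.
      exact: measurable_cst.
    exact: measurable_indic.
  have Ls r : L (fun x => \sum_(i <- r) c i * \1_(B i) x).
    apply: (Lb _ (\sum_(i <- r) `|c i|)) => // x.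
    rewrite (le_trans (ler_norm_sum _ _ _))// ler_sum// => i _.
    rewrite normrM ler_piMr// indicE ger0_norm// lern1 leq_b1//.
  split=> //; split=> //; elim: s => [|i s IH].
    rewrite (_ : (fun x => _) = cst 0)//.
    by apply/funext => x; rewrite big_nil.
  rewrite (_ : (fun x => _) =
    (fun x => c i * \1_(B i) x + \sum_(j <- s) c j * \1_(B j) x)); last first.
    by apply/funext => x; rewrite big_cons.
  by apply: Hlin => //; [exact: Li|exact: Hi].
have Hpos (f : T -> R) : measurable_fun [set: T] f -> L f -> (forall x, 0 <= f x) -> H f.
  move=> mf Lf f0.
  have mf' : measurable_fun [set: T] (EFin \o f) by exact/measurable_EFinP.
  have f0' x : [set: T] x -> (0 <= (EFin \o f) x)%E by rewrite lee_fin.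
  pose F := nnsfun_approx measurableT mf'.
  have cF x : F k x @[k --> \oo] --> f x.
    have := @cvg_nnsfun_approx _ _ _ _ measurableT _ mf' f0' x I.
    by move=> /fine_cvg.
  have Fle k x : F k x <= f x.
    rewrite -lee_fin /F nnsfun_approxE.
    exact: (le_approx k f0' I).
  apply: (Hlim (fun k => (F k : T -> R)) f) => //.
    move=> k; have -> : (F k : T -> R) = (fun x =>
      \sum_(y <- finmap.enum_fset (fset_set (range (F k)))) y * \1_(F k @^-1` [set y]) x).
      apply/funext => x; rewrite {1}(fimfunE (F k)) fsbig_finite//.
    by apply: (Hsum _ _ id (fun y => F k @^-1` [set y]) _).2.2.
  by move=> k x; rewrite !ger0_norm ?f0.
move=> f mf Lf.
have mp := measurable_funrpos mf; have mn := measurable_funrneg mf.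
have Lp : L f^\+.
  apply: (Lle f) => // x; rewrite ger0_norm ?funrpos_ge0// /funrpos.
  by rewrite ge_max ler_norm normr_ge0.
have Ln : L f^\-.
  apply: (Lle f) => // x; rewrite ger0_norm ?funrneg_ge0// /funrneg.
  by rewrite ge_max normr_ge0 andbT -normrN ler_norm.
have -> : f = (fun x => (-1) * f^\- x + f^\+ x).
  apply/funext => x; rewrite mulN1r addrC.
  by rewrite -[LHS]/(f x) -{1}(funrposBneg f).
by apply: Hlin => //; apply: Hpos.
Qed.

End monotone_class.

Section density.
Context d (T : measurableType d) (R : realType).

(** The functions that steps over [G] approximate form a class to which the monotone class theorem
    applies, with [L] the square-integrable functions. In the limit step the two errors are taken
    below e / 4 because [ip_add_le] doubles each. *)
Lemma L2_dense_indic (mu : probability T R) (G : set (set T)) :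
  measurable = <<s G >> -> setI_closed G -> G [set: T] ->
  forall f, L2 mu f -> forall e, 0 < e ->
  exists2 s : seq (R * set T), (forall p, p \in s -> G p.2) &
    let r := fun x => \sum_(p <- s) p.1 * \1_(p.2) x in
    ip mu (fun x => f x - r x) (fun x => f x - r x) < e.
Proof.
move=> mG GI GT.
pose step s x : R := \sum_(p <- s) p.1 * \1_(p.2 : set T) x.
pose H (f : T -> R) := forall e, 0 < e ->
  exists2 s : seq (R * set T), (forall p, p \in s -> G p.2) &
    ip mu (fun x => f x - step s x) (fun x => f x - step s x) < e.
have step2 s : (forall p, p \in s -> G p.2) -> L2 mu (step s).
  elim: s => [|p s IH] sG.
    rewrite (_ : step _ = cst 0); first exact: L2_cst.
    by apply/funext => x; rewrite /step big_nil.
  rewrite (_ : step _ = fun x => p.1 * \1_(p.2) x + step s x); last first.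
    by apply/funext => x; rewrite /step big_cons.
  apply: L2ZD; last by apply: IH => q qs; apply: sG; rewrite inE qs orbT.
  apply: L2_indic; rewrite mG; apply: sub_sigma_algebra.
  by apply: sG; rewrite mem_head.
suff HH f : L2 mu f -> H f by exact: HH.
move=> f2; apply: (@functional_monotone_class _ T R G (L2 mu) H) => //.
- exact: L2_cst.
- by move=> {f2}f g f2 mg gf; exact: L2_le f2 mg gf.
- move=> B GB e e0; exists [:: (1, B)] => [p|].
    by rewrite inE => /eqP ->.
  rewrite (_ : (fun x => _) = cst 0).
    by rewrite ip0r.
  by apply/funext => x; rewrite /step big_seq1 mul1r subrr.
- move=> a {f2}f g mf mg f2 g2 Hf Hg e e0.
  have c0 : 0 < 4 * (a ^+ 2 + 1) by rewrite mulr_gt0// ltr_wpDl ?sqr_ge0.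
  have [s sG sf] := Hf (e / (4 * (a ^+ 2 + 1))) (divr_gt0 e0 c0).
  have [t tG tg] := Hg (e / 4) (divr_gt0 e0 (ltr0n _ 4)).
  exists ([seq (a * p.1, p.2) | p <- s] ++ t).
    by move=> p; rewrite mem_cat => /orP[/mapP[q qs ->]|]; [exact: (sG q)|exact: tG].
  set u := fun x => f x - step s x; set v := fun x => g x - step t x.
  have u2 : L2 mu u by apply: L2B => //; exact: step2.
  have v2 : L2 mu v by apply: L2B => //; exact: step2.
  rewrite (_ : (fun x => _) = (fun x => a * u x + v x)); last first.
    apply/funext => x; rewrite /step big_cat big_map /= /u /v /step.
    under eq_bigr do rewrite -mulrA.
    by rewrite -mulr_sumr; ring.
  exact: ipZD_lt.
- move=> F {f2}f mF HF mf f2 Fle Ff e e0.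
  have /cvgrPdist_lt/(_ (e / 4) (divr_gt0 e0 (ltr0n _ 4)))[k _ /(_ k (leqnn _))] :=
    ip_dct0 mF f2 Ff Fle.
  have Fk2 : L2 mu (F k) by apply: L2_le f2 (mF k) (Fle k).
  rewrite sub0r normrN ger0_norm ?ip_ge0// => fk.
  have [s sG sF] := HF k (e / 4) (divr_gt0 e0 (ltr0n _ 4)).
  exists s => //.
  rewrite (_ : (fun x => _) = (fun x => (f x - F k x) + (F k x - step s x))).
    apply: (le_lt_trans (ip_add_le _ _)); first exact: L2B.
      by apply: L2B => //; exact: step2.
    lra.
  by apply/funext => x; ring.
- exact: f2.1.
Qed.

End density.

(** * Conditional expectation given a random variable *)

Section projection.
Context d d' (Om : measurableType d) (T : measurableType d') (R : realType).
Variables (P : probability Om R) (X : Om -> T) (mX : measurable_fun [set: Om] X)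
  (mu : probability T R).
Hypothesis muE : forall B, measurable B -> mu B = P (X @^-1` B).

Lemma integral_law (f : T -> \bar R) : measurable_fun [set: T] f ->
  (forall x, 0 <= f x)%E -> (\int[mu]_x f x = \int[P]_w f (X w))%E.
Proof.
move=> mf f0.
rewrite (eq_measure_integral (pushforward P X)); last first.
  by move=> B mB _; exact: muE.
exact: ge0_integral_pushforward.
Qed.

Lemma rint_law (f : T -> R) : measurable_fun [set: T] f ->
  rint mu f <-> rint P (f \o X).
Proof.
move=> mf.
have E : (\int[mu]_x `|(f x)%:E| = \int[P]_w `|(f (X w))%:E|)%E.
  by rewrite integral_law//; apply: measurableT_comp => //; exact/measurable_EFinP.
split=> /integrableP[_ fo]; apply/integrableP; split.
- by apply/measurable_EFinP; exact: measurableT_comp.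
- by rewrite -E.
- exact/measurable_EFinP.
- by rewrite E.
Qed.

Lemma Rint_law (f : T -> R) : rint mu f ->
  \int[mu]_x f x = \int[P]_w f (X w).
Proof.
move=> fi; have mf := rint_measurable fi; congr fine.
rewrite (eq_measure_integral (pushforward P X)); last first.
  by move=> B mB _; exact: muE.
rewrite integral_pushforward//; first exact/measurable_EFinP.
exact/rint_law.
Qed.

Lemma L2_law (f : T -> R) : measurable_fun [set: T] f ->
  L2 mu f <-> L2 P (f \o X).
Proof.
move=> mf; have m2 : measurable_fun [set: T] (fun x => f x ^+ 2).
  exact: measurable_funX.
split=> -[_ f2]; split=> //; last exact/(rint_law m2).
  exact: measurableT_comp.
exact/(rint_law m2).
Qed.

Lemma ip_law (f g : T -> R) : L2 mu f -> L2 mu g ->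
  ip mu f g = ip P (f \o X) (g \o X).
Proof. by move=> f2 g2; rewrite /ip Rint_law//; exact: L2M. Qed.

(** [g] is E[Y | X] as a function on the range of [X]: the derivative, with respect to the law of
    [X], of the image under [X] of the signed measure Y dP. A priori it is only integrable;
    truncation shows that it is square-integrable. *)
Lemma L2_cond_exp (Y : Om -> R) : L2 P Y ->
  exists2 g, L2 mu g & forall u, L2 mu u -> ip P Y (u \o X) = ip mu g u.
Proof.
move=> Y2.
have Yi : P.-integrable [set: Om] (EFin \o Y) by exact: L2_rint.
pose nu : {charge set T -> \bar R} := pushforward (induced_charge Yi) X.
have numu : nu mX `<< mu.
  apply/null_content_dominatesP => B mB muB.
  rewrite /nu/= /pushforward /induced_charge.
  apply: null_set_integral.
  - by rewrite -[X in measurable X]setTI; exact: mX.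
  - by apply: measurable_funTS; exact: measurable_int Yi.
  - exact: etrans (esym (muE mB)) muB.
pose g x := fine ((Radon_Nikodym (nu mX) mu) x).
have gE x : (Radon_Nikodym (nu mX) mu) x = (g x)%:E.
  by rewrite fineK//; exact: Radon_Nikodym_fin_num.
have gi : rint mu g.
  rewrite /rint (_ : EFin \o g = Radon_Nikodym (nu mX) mu); last first.
    by apply/funext => x; rewrite gE.
  exact: Radon_Nikodym_integrable.
have mg := rint_measurable gi.
(* Only bounded [u] at first: as long as [g] is merely integrable, its product with a
   square-integrable [u] need not be. *)
have bounded_case (u : T -> R) (M : R) : measurable_fun [set: T] u ->
    (forall x, `|u x| <= M) -> ip P Y (u \o X) = ip mu g u.
  move=> mu' uM.
  apply: (@functional_monotone_class _ T R measurable
    [set u : T -> R | exists M : R, forall x, `|u x| <= M]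
    [set u : T -> R | ip P Y (u \o X) = ip mu g u]) => //.
  - by rewrite sigma_algebra_id//; exact: sigma_algebra_measurable.
  - exact: measurableI.
  - by move=> c; exists `|c|.
  - by move=> v1 v2 [M1 H1] _ H2; exists M1 => x; exact: le_trans (H2 x) (H1 x).
  - move=> B mB /=.
    have : nu mX B = (\int[mu]_(x in B) (g x)%:E)%E.
      by rewrite (Radon_Nikodym_integral numu mB); apply: eq_integral => x _.
    rewrite /nu/= /pushforward /induced_charge => /(congr1 fine) E.
    have {E} : \int[P]_(w in X @^-1` B) Y w = \int[mu]_(x in B) g x by [].
    by rewrite Rintegral_mkcond [RHS]Rintegral_mkcond !patch_indic.
  - move=> a v1 v2 m1 m2 [M1 H1] [M2 H2] /=.
    have b1 : L2 mu v1 by exact: L2_bounded H1.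
    have b2 : L2 mu v2 by exact: L2_bounded H2.
    move=> E1 E2.
    have gb (v : T -> R) (M' : R) : measurable_fun [set: T] v ->
       (forall x, `|v x| <= M') -> rint mu (fun x => v x * g x).
      move=> mv vM; apply: (rint_le _ (rintZ M' gi)).
        exact: measurable_funM.
      move=> x; rewrite !normrM ler_wpM2r// (le_trans (vM x))// ler_norm//.
    rewrite ipC (_ : _ \o X = fun w => a * (v1 \o X) w + (v2 \o X) w)//.
    rewrite ipZD//; last 2 first.
    + by apply/(L2_law m1).
    + by apply/(L2_law m2).
    rewrite ipC E1 (ipC P (v2 \o X)) E2 !(ipC mu g) /ip.
    rewrite -Rint_ZD//; [|exact: gb H1|exact: gb H2].
    by apply: eq_Rintegral => x _; ring.
  - move=> F f mF HF mf [M' fM] Fle Ff /=.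
    have f2 : L2 mu f by exact: L2_bounded fM.
    have c1 : ip P Y (F k \o X) @[k --> \oo] --> ip P Y (f \o X).
      rewrite ipC (_ : (fun k => _) = (fun k => ip P (F k \o X) Y)); last first.
        by apply/funext => k; rewrite ipC.
      apply: ip_dct => //.
      + by move=> k; exact: measurableT_comp.
      + exact/L2_law.
      + by move=> w; exact: Ff.
      + by move=> k w; exact: Fle.
    have c2 : ip mu g (F k) @[k --> \oo] --> ip mu g f.
      apply: (proj2 (@Rint_dct _ _ _ mu (fun k x => g x * F k x)
        (fun x => g x * f x) (fun x => M' * `|g x|) _ _ _ _ _)).
      + by move=> k; exact: measurable_funM.
      + exact: measurable_funM.
      + by apply: aeW => x; apply: cvgM; [exact: cvg_cst|exact: Ff].
      + by apply: rintZ; exact: integrable_norm gi.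
      + apply: aeW => x k; rewrite normrM mulrC ler_wpM2r//.
        exact: le_trans (Fle k x) (fM x).
    have E : (fun k => ip P Y (F k \o X)) = (fun k => ip mu g (F k)).
      by apply/funext => k; exact: HF.
    by rewrite E in c1; exact: (cvg_unique _ c1 c2).
  - by exists M.
pose t (n : nat) x := g x * \1_[set y | `|g y| <= n%:R] x.
have mt n : measurable_fun [set: T] (t n).
  apply: measurable_funM => //; apply: measurable_indic.
  rewrite (_ : [set y | _] = (Num.norm \o g) @^-1` [set` `]-oo, n%:R]]); last first.
    by apply/seteqP; split => y; rewrite /= in_itv.
  have mng : measurable_fun [set: T] (Num.norm \o g) by exact: measurableT_comp.
  by rewrite -[X in measurable X]setTI; exact: mng.
have tn n x : `|t n x| <= n%:R.
  rewrite /t indicE; have [/set_mem/= gn|_] := boolP (x \in _).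
    by rewrite mulr1.
  by rewrite mulr0 normr0.
have t2 n : L2 mu (t n) by exact: L2_bounded (tn n).
(* For the truncation, <g, t n> = <t n, t n>, and the bounded case gives <g, t n> = <Y, t n o X>.
   Cauchy-Schwarz then bounds the norm of [t n] by that of [Y], uniformly in [n]; monotone
   convergence passes this to [g]. *)
have tC n : ip mu (t n) (t n) <= ip P Y Y.
  have H := bounded_case _ _ (mt n) (tn n).
  have E : ip mu g (t n) = ip mu (t n) (t n).
    apply: eq_Rintegral => x _; rewrite /t indicE.
    by case: (x \in _); rewrite ?mulr1 ?mulr0.
  have := ip_CS Y2 (proj1 (L2_law (mt n)) (t2 n)).
  rewrite H E -ip_law// expr2.
  have [->|t0] := eqVneq (ip mu (t n) (t n)) 0; first by rewrite ip_ge0.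
  by rewrite ler_pM2r// lt_neqAle eq_sym t0 ip_ge0.
have g2 : L2 mu g.
  split=> //; apply/integrableP; split.
    by apply/measurable_EFinP; exact: measurable_funX.
  apply: (@le_lt_trans _ _ (ip P Y Y)%:E); last exact: ltry.
  have cvg_t : (\int[mu]_x (t n x ^+ 2)%:E)%E @[n --> \oo] -->
      (\int[mu]_x (g x ^+ 2)%:E)%E.
    under [X in _ --> X]eq_integral => x _.
      have <- : limn (fun n => (t n x ^+ 2)%:E) = (g x ^+ 2)%:E.
        apply/cvg_lim => //; apply: cvg_near_cst.
        have [N _ HN] : \forall n \near \oo, `|g x| <= n%:R.
          exact: nbhs_infty_ger.
        by exists N => // n /HN gn; rewrite /t indicE mem_set// mulr1.
      over.
    apply: cvg_monotone_convergence => //.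
    - by move=> n; apply/measurable_EFinP; exact: measurable_funX.
    - by move=> n x _; rewrite lee_fin sqr_ge0.
    - move=> x _ m n mn; rewrite lee_fin /t !indicE.
      have [/set_mem/= gm|_] := boolP (x \in [set y | `|g y| <= m%:R]).
        by rewrite mem_set//= (le_trans gm)// ler_nat.
      by rewrite mulr0 expr0n sqr_ge0.
  under eq_integral do rewrite /= ger0_norm ?sqr_ge0//.
  apply: (cvge_to_le cvg_t); apply: nearW => n.
  have := tC n; rewrite -lee_fin; apply: le_trans.
  rewrite /ip /Rintegral fineK; last exact: (integrable_fin_num _ (L2M (t2 n) (t2 n))).
  by under [in leRHS]eq_integral do rewrite -expr2.
exists g => // u u2.
apply: (@functional_monotone_class _ T R measurable (L2 mu)
    [set u : T -> R | ip P Y (u \o X) = ip mu g u]) => //; last exact: u2.1.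
- by rewrite sigma_algebra_id//; exact: sigma_algebra_measurable.
- exact: measurableI.
- exact: L2_cst.
- by move=> v1 v2 H1 m2 H2; exact: L2_le H1 m2 H2.
- move=> B mB /=; apply: (bounded_case _ 1); first exact: measurable_indic.
  by move=> x; rewrite indicE ger0_norm// lern1 leq_b1.
- move=> a v1 v2 m1 m2 H1 H2 /= E1 E2.
  rewrite ipC (ipC mu g) (_ : _ \o X = fun w => a * (v1 \o X) w + (v2 \o X) w)//.
  rewrite !ipZD//; [|exact/L2_law|exact/L2_law].
  by rewrite ipC E1 (ipC P (v2 \o X)) E2 !(ipC mu g).
- move=> F f mF HF mf f2 Fle Ff /=.
  have c1 : ip P Y (F k \o X) @[k --> \oo] --> ip P Y (f \o X).
    rewrite ipC (_ : (fun k => _) = (fun k => ip P (F k \o X) Y)); last first.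
      by apply/funext => k; rewrite ipC.
    apply: ip_dct => //.
    + by move=> k; exact: measurableT_comp.
    + exact/L2_law.
    + by move=> w; exact: Ff.
    + by move=> k w; exact: Fle.
  have c2 : ip mu g (F k) @[k --> \oo] --> ip mu g f.
    rewrite ipC (_ : (fun k => _) = (fun k => ip mu (F k) g)); last first.
      by apply/funext => k; rewrite ipC.
    exact: ip_dct.
  have E : (fun k => ip P Y (F k \o X)) = (fun k => ip mu g (F k)).
    by apply/funext => k; exact: HF.
  by rewrite E in c1; exact: (cvg_unique _ c1 c2).
Qed.

End projection.

(** * Rectangles and powers of a probability *)

Section rectangles.
Context d (T : measurableType d) (R : realType).

Definition rect n (E : 'I_n -> set T) : set (n.-tuple T) :=
  [set t | forall i, E i (tnth t i)].

Definition rects n : set (set (n.-tuple T)) :=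
  [set B | exists2 E : 'I_n -> set T, (forall i, measurable (E i)) & B = rect E].

Lemma measurable_rect n (E : 'I_n -> set T) :
  (forall i, measurable (E i)) -> measurable (rect E).
Proof.
move=> mE; rewrite (_ : rect E = \bigcap_(i : 'I_n) (@tnth n T ^~ i @^-1` E i)).
  apply: fin_bigcap_measurable => // i _.
  by rewrite -[X in measurable X]setTI; exact: measurable_tnth.
by apply/seteqP; split => t; [move=> tE i _; exact: tE|move=> tE i; exact: (tE i I)].
Qed.

Lemma rects_setI n : setI_closed (@rects n).
Proof.
move=> _ _ [E mE ->] [F mF ->]; exists (fun i => E i `&` F i).
  by move=> i; exact: measurableI.
apply/seteqP; split => t; first by move=> [tE tF] i; split; [exact: tE|exact: tF].
by move=> tEF; split=> i; have [] := tEF i.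
Qed.

Lemma rects_setT n : @rects n [set: n.-tuple T].
Proof. by exists (fun=> setT) => //; apply/seteqP; split. Qed.

Lemma measurable_rectsE n : @measurable _ (n.-tuple T) = <<s @rects n >>.
Proof.
apply/seteqP; split; last first.
  apply: smallest_sub; first exact: sigma_algebra_measurable.
  by move=> _ [E mE ->]; exact: measurable_rect.
apply: smallest_sub; first exact: smallest_sigma_algebra.
(* In dimension 0 the product sigma-field is generated by an empty family, and [inord] below needs a
   nonempty ordinal type. *)
case: n => [|n]; first by rewrite big_ord0.
rewrite -bigcup_mkord_ord; apply: bigcup_sub => i Ii _ [B mB <-].
apply: sub_sigma_algebra.
exists (fun j => if j == inord i then B else setT) => [j|]; first by case: ifP.
rewrite setTI; apply/seteqP; split => t /=.
  by move=> Bt j; case: ifP => // /eqP ->.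
by move=> /(_ (inord i)); rewrite eqxx.
Qed.

Lemma indic_rect n (E : 'I_n -> set T) t :
  \1_(rect E) t = \prod_(i < n) \1_(E i) (tnth t i) :> R.
Proof.
rewrite indicE; have [/set_mem tE|tE] := boolP (t \in rect E).
  by rewrite big1// => i _; rewrite indicE mem_set//; exact: tE.
have [i Ei] : exists i, ~ E i (tnth t i).
  by apply/existsNP => H; move/negP: tE; apply; exact: mem_set.
by rewrite (bigD1 i)//= indicE memNset ?mul0r.
Qed.

Lemma tuple_prob_rect n (mu : 'I_n -> probability T R) (E : 'I_n -> set T) :
  (forall i, measurable (E i)) ->
  tuple_prob mu (rect E) = (\prod_(i < n) fine (mu i (E i)))%:E.
Proof.
elim: n mu E => [|n IH] mu E mE.
  rewrite /= big_ord0 diracE mem_set//.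
  by case.
rewrite /= /distribution /pushforward.
rewrite (_ : _ @^-1` _ = E ord0 `*` rect (fun i => E (lift ord0 i))).
  rewrite product_measure1E//; last exact: measurable_rect.
  rewrite [X in (_ * X)%E]IH// big_ord_recl EFinM fineK//.
  exact: fin_num_measure.
apply/seteqP; split => -[x t] /=.
  move=> H; split => [|i]; first by have := H ord0.
  by have := H (lift ord0 i); rewrite tnthS.
move=> [H0 H] i; have [->//|] := eqVneq i ord0.
move=> i0; have [j ->] : exists j, i = lift ord0 j.
  by case: (unliftP ord0 i) i0 => [j ->|->]; [exists j|rewrite eqxx].
by rewrite tnthS; exact: H.
Qed.

Lemma prob_pow_rect n (mu : probability T R) (E : 'I_n -> set T) :
  (forall i, measurable (E i)) ->
  prob_pow n mu (rect E) = (\prod_(i < n) fine (mu (E i)))%:E.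
Proof. exact: tuple_prob_rect. Qed.

Lemma rects_measure_unique n (m1 : probability (n.-tuple T) R)
    (m2 : {measure set (n.-tuple T) -> \bar R}) :
  (forall E, (forall i, measurable (E i)) -> m1 (rect E) = m2 (rect E)) ->
  forall B, measurable B -> m1 B = m2 B.
Proof.
move=> m12 B mB.
apply: (@measure_unique _ _ _ (@rects n) (fun=> setT)) => //.
- exact: measurable_rectsE.
- exact: rects_setI.
- by move=> _; exact: rects_setT.
- by rewrite bigcup_const.
- by move=> _ [E mE ->]; exact: m12.
- by move=> _; rewrite (le_lt_trans (probability_le1 _ _))// ltry.
Qed.

Definition tuple_perm n (s : 'S_n) (t : n.-tuple T) : n.-tuple T :=
  [tuple tnth t (s i) | i < n].

Lemma measurable_tuple_perm n (s : 'S_n) :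
  measurable_fun [set: n.-tuple T] (tuple_perm s).
Proof.
apply/measurable_fun_tnthP => i.
rewrite (_ : _ \o _ = @tnth n T ^~ (s i)); first exact: measurable_tnth.
by apply/funext => t /=; rewrite tnth_mktuple.
Qed.

Lemma preimage_tuple_perm n (s : 'S_n) E :
  tuple_perm s @^-1` rect E = rect (fun i => E ((s^-1)%g i)).
Proof.
apply/seteqP; split => t /= H i.
  by have := H ((s^-1)%g i); rewrite tnth_mktuple permKV.
by rewrite tnth_mktuple; have := H (s i); rewrite permK.
Qed.

Lemma prob_pow_perm n (s : 'S_n) (mu : probability T R) B : measurable B ->
  prob_pow n mu B = prob_pow n mu (tuple_perm s @^-1` B).
Proof.
pose f : {mfun _ >-> _} := HB.pack (tuple_perm s)
  (isMeasurableFun.Build _ _ _ _ _ (measurable_tuple_perm s)).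
move=> mB; apply: (@rects_measure_unique n (prob_pow n mu)
  (distribution (prob_pow n mu) f)) => // E mE.
transitivity (prob_pow n mu (rect (fun i => E ((s^-1)%g i)))); last first.
  by rewrite -preimage_tuple_perm.
rewrite !prob_pow_rect//.
congr EFin; rewrite (reindex_inj (@perm_inj _ (s^-1)%g))/=.
by apply: eq_bigr.
Qed.

(** [Om] is arbitrary because the lemma serves both for [Omega] and for [Omega] with the coarser
    sigma-field generated by [D]. *)
Lemma measurable_prob_pow d' (Om : measurableType d') (D : Om -> probability T R) n :
  (forall C, measurable C -> measurable_fun [set: Om] (fun w => fine (D w C))) ->
  forall B, measurable B -> measurable_fun [set: Om] (fun w => prob_pow n (D w) B).
Proof.
move=> mD B; rewrite measurable_rectsE => mB.
suff : <<s @rects n >> `<=` [set B | measurable B /\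
    measurable_fun [set: Om] (fun w => prob_pow n (D w) B)].
  by move=> /(_ _ mB)[].
apply: (lambda_system_subset (@rects_setI n)) => //; last first.
- move=> _ [E mE ->]; split; first exact: measurable_rect.
  under eq_fun do rewrite prob_pow_rect//.
  apply/measurable_EFinP; apply: measurable_prod => i _; exact: mD.
split => //.
- split => //; under eq_fun do rewrite probability_setT.
  exact: measurable_cst.
- move=> B1 B2 B21 [m1 f1] [m2 f2]; split; first exact: measurableD.
  rewrite (_ : (fun w => _) =
     (fun w => prob_pow n (D w) B1 - prob_pow n (D w) B2)%E).
    exact: emeasurable_funB.
  apply/funext => w; rewrite measureD//; first by rewrite setIidr.
  by rewrite (le_lt_trans (probability_le1 _ _))// ltry.
- move=> F ndF mF; split; first by apply: bigcup_measurable => k _; exact: (mF k).1.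
  apply: (@emeasurable_fun_cvg _ _ _ _ (fun k w => prob_pow n (D w) (F k))).
    by move=> k; exact: (mF k).2.
  move=> w _; apply: nondecreasing_cvg_mu => //.
    by move=> k; exact: (mF k).1.
  by apply: bigcup_measurable => k _; exact: (mF k).1.
Qed.

End rectangles.

(** * The Polya urn *)

Lemma emeasurable_sum_seq d (T : measurableType d) (R : realType) (I : eqType)
    (s : seq I) (F : I -> T -> \bar R) :
  (forall i, i \in s -> measurable_fun [set: T] (F i)) ->
  measurable_fun [set: T] (fun x => \sum_(i <- s) F i x)%E.
Proof.
elim: s => [|i s IH] mF.
  by under eq_fun do rewrite big_nil; exact: measurable_cst.
under eq_fun do rewrite big_cons.
apply: emeasurable_funD; first by apply: mF; rewrite mem_head.
by apply: IH => j js; apply: mF; rewrite inE js orbT.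
Qed.

Section polya_predictive_identity.
Context d (A : measurableType d) (R : realType)
  (alpha : {finite_measure set A -> \bar R}).
Local Open Scope ereal_scope.
Local Notation theta := (fine (alpha setT)).

(** The unnormalised predictive law, bundled as a measure so that the theory of integration applies
    to the iterated integrals of [polya_law]. *)
Fixpoint urn (s : seq A) : {measure set A -> \bar R} :=
  if s is a :: s' then measure_add (\d_a) (urn s') else alpha.

Lemma urnE s B : urn s B = alpha B + \sum_(a <- s) \d_a B.
Proof.
elim: s => [|a s IH]; first by rewrite big_nil adde0.
rewrite big_cons /= /measure_add /msum/=.
by rewrite !big_ord_recl big_ord0 adde0 /= IH addeCA.
Qed.

Definition total (s : seq A) : R := (theta + (size s)%:R)%R.

Lemma totalV_ge0 s : (0 <= (total s)^-1)%R.
Proof. by rewrite invr_ge0 addr_ge0// fine_ge0. Qed.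

Definition predictive s : {measure set A -> \bar R} :=
  mscale (NngNum (totalV_ge0 s)) (urn s).

Lemma polya_predictiveE s : polya_predictive alpha s = predictive s.
Proof.
apply/funext => B.
by rewrite /predictive/= /mscale/= muleC urnE.
Qed.

Lemma polya_law_cons s B Bs : polya_law alpha s (B :: Bs) =
  \int[predictive s]_(a in B) polya_law alpha (rcons s a) Bs.
Proof. by rewrite /= polya_predictiveE. Qed.

(** One list for each position of [Cs]: it describes the event that the next draw copies the draw at
    that position and falls in [B]. *)
Fixpoint cap_each (Cs : seq (set A)) (B : set A) : seq (seq (set A)) :=
  if Cs is C :: Cs' then (C `&` B :: Cs') :: [seq C :: Ds | Ds <- cap_each Cs' B]
  else [::].

(** The default [setT] makes the condition trivial past the end of the list, so that no bound on [k]
    has to be carried. *)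
Definition all_measurable (Cs : seq (set A)) := forall k, measurable (nth setT Cs k).

Lemma all_measurable_cons C Cs :
  all_measurable (C :: Cs) <-> measurable C /\ all_measurable Cs.
Proof.
split=> [H|[mC mCs] [|k]].
- by split; [exact: (H 0%N)|move=> k; exact: (H k.+1)].
- exact: mC.
- exact: mCs.
Qed.

Lemma cap_each_measurable Cs B Ds :
  measurable B -> all_measurable Cs -> Ds \in cap_each Cs B ->
  size Ds = size Cs /\ all_measurable Ds.
Proof.
move=> mB; elim: Cs Ds => [|C Cs IH] Ds //= /all_measurable_cons[mC mCs].
rewrite inE => /predU1P[->|/mapP[Es EsI ->]].
  by split => //; apply/all_measurable_cons; split => //; exact: measurableI.
have [<- mEs] := IH _ mCs EsI.
by split => //; apply/all_measurable_cons.
Qed.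

Lemma polya_law_ge0 s Bs : 0 <= polya_law alpha s Bs.
Proof.
elim: Bs s => [|B Bs IH] s //=.
by rewrite polya_predictiveE; apply: integral_ge0.
Qed.

Lemma urn_rcons s a B : urn (rcons s a) B = urn s B + \d_a B.
Proof. by rewrite !urnE -cats1 big_cat big_seq1 addeA. Qed.

(** [polya_law] unfolds at the first draw, whereas this identity expands the last one: it either
    takes its value from [urn s] or copies one of the draws constrained by [Cs]. *)
Let pred_id s Cs B := polya_law alpha s (rcons Cs B) =
  ((theta + (size s + size Cs)%:R)^-1)%:E *
  (urn s B * polya_law alpha s Cs + \sum_(Ds <- cap_each Cs B) polya_law alpha s Ds).

(** Measurability and the identity need each other. Removing the last set by the identity makes the
    dependence on [a] explicit, and the identity for a longer list is the integral of the one for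
    its tail, which takes measurability. The induction is on the length because [cap_each] changes
    the sets but not their number. *)
Let polya_law_induct n : forall Cs, size Cs = n -> all_measurable Cs ->
  (forall s, measurable_fun [set: A] (fun a => polya_law alpha (rcons s a) Cs)) /\
  (forall s B, measurable B -> pred_id s Cs B).
Proof.
have murn s B : measurable B -> measurable_fun [set: A] (fun a => urn (rcons s a) B).
  move=> mB; under eq_fun do rewrite urn_rcons.
  apply: emeasurable_funD => //.
  by apply: measurable_fun_dirac.
have sumge0 s (l : seq (seq (set A))) : 0 <= \sum_(Ds <- l) polya_law alpha s Ds.
  by apply: sume_ge0 => Ds _; exact: polya_law_ge0.
elim: n => [|n IH].
  move=> Cs /size0nil -> _; split; first by move=> s; exact: measurable_cst.
  move=> s B mB; rewrite /pred_id /= big_nil adde0 mule1 polya_predictiveE.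
  rewrite integral_cst// mul1e /predictive /= /mscale /= /total addn0.
  by [].
move=> Cs sCs mCs; split.
  case/lastP: Cs sCs mCs => [//|Cs B]; rewrite size_rcons => -[sCs] mCsB s.
  have mB : measurable B.
    by have := mCsB (size Cs); rewrite nth_rcons ltnn eqxx.
  have mCs : all_measurable Cs.
    move=> k; have := mCsB k; rewrite nth_rcons.
    case: ltnP => // kC _; rewrite nth_default//.
  have [mL HL] := IH _ sCs mCs.
  rewrite (_ : (fun a => _) = (fun a =>
    ((theta + (size (rcons s point) + size Cs)%:R)^-1)%:E *
    (urn (rcons s a) B * polya_law alpha (rcons s a) Cs +
     \sum_(Ds <- cap_each Cs B) polya_law alpha (rcons s a) Ds))); last first.
    by apply/funext => a; rewrite HL// !size_rcons.
  apply: measurable_funeM; apply: emeasurable_funD.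
    by apply: emeasurable_funM => //; exact: murn.
  apply: emeasurable_sum_seq => Ds DsI.
  have [sDs mDs] := cap_each_measurable mB mCs DsI.
  by have [+ _] := IH Ds (etrans sDs sCs) mDs; exact.
case: Cs sCs mCs => [//|C Cs] /= [sCs] /all_measurable_cons[mC mCs] s B mB.
have [mL HL] := IH _ sCs mCs.
rewrite /pred_id rcons_cons polya_law_cons.
have HK a : (theta + (size (rcons s a) + size Cs)%:R =
    theta + (size s + size (C :: Cs))%:R)%R.
  by rewrite size_rcons /= addSnnS.
have mDs Ds : Ds \in cap_each Cs B -> forall s,
    measurable_fun [set: A] (fun a => polya_law alpha (rcons s a) Ds).
  move=> DsI; have [sDs mDs] := cap_each_measurable mB mCs DsI.
  by have [+ _] := IH Ds (etrans sDs sCs) mDs; exact.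
under eq_integral => a _.
  rewrite HL// HK.
  over.
have K0 : (0 <= (theta + (size s + size (C :: Cs))%:R)^-1)%R.
  by rewrite invr_ge0 addr_ge0// fine_ge0.
have mS : measurable_fun [set: A] (fun a => \sum_(Ds <- cap_each Cs B)
    polya_law alpha (rcons s a) Ds).
  by apply: emeasurable_sum_seq => Ds /mDs; exact.
have mUB : measurable_fun [set: A] (fun a =>
    urn (rcons s a) B * polya_law alpha (rcons s a) Cs).
  by apply: emeasurable_funM => //; exact: murn.
have mDB : measurable_fun [set: A] (fun a =>
    \d_a B * polya_law alpha (rcons s a) Cs).
  by apply: emeasurable_funM => //; exact: measurable_fun_dirac.
have ge0UB a : C a -> 0 <= urn (rcons s a) B * polya_law alpha (rcons s a) Cs.
  by rewrite mule_ge0 ?polya_law_ge0.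
rewrite ge0_integralZl_EFin//; last 2 first.
- by move=> a Ca; rewrite adde_ge0 ?ge0UB.
- by apply: measurable_funTS; exact: emeasurable_funD.
congr *%E.
rewrite ge0_integralD//; last 2 first.
- exact: measurable_funTS.
- exact: measurable_funTS.
under eq_integral do rewrite urn_rcons ge0_muleDl ?polya_law_ge0//.
rewrite ge0_integralD//; last 4 first.
- by move=> a _; rewrite mule_ge0 ?polya_law_ge0.
- by apply: measurable_funTS; apply: measurable_funeM.
- by move=> a _; rewrite mule_ge0 ?polya_law_ge0.
- exact: measurable_funTS.
rewrite ge0_integralZl//; last 2 first.
- exact: measurable_funTS.
- by move=> a _; exact: polya_law_ge0.
rewrite -polya_law_cons -addeA; congr (_ + _).
rewrite big_cons big_map polya_law_cons; congr (_ + _).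
  (* The unit mass that the draw [a] adds to the urn restricts the integral over [C] to the points
     of [B], which is the head of the list [cap_each (C :: Cs) B]. *)
  rewrite integral_mkcondr; apply: eq_integral => a _.
  rewrite patchE diracE; case: ifPn => aB; first by rewrite mul1e.
  by rewrite mul0e.
have int_sum (l : seq (seq (set A))) : (forall Ds, Ds \in l ->
    measurable_fun [set: A] (fun a => polya_law alpha (rcons s a) Ds)) ->
    \int[predictive s]_(a in C) (\sum_(Ds <- l) polya_law alpha (rcons s a) Ds) =
    \sum_(Ds <- l) polya_law alpha s (C :: Ds).
  elim: l => [|Ds l IHl] ml.
    under eq_integral do rewrite big_nil.
    by rewrite big_nil integral0.
  under eq_integral do rewrite big_cons.
  have mDsl : measurable_fun [set: A]
      (fun a => \sum_(Ds <- l) polya_law alpha (rcons s a) Ds).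
    by apply: emeasurable_sum_seq => Es El; apply: ml; rewrite inE El orbT.
  rewrite ge0_integralD//; last 3 first.
  - by move=> a _; exact: polya_law_ge0.
  - by apply: measurable_funTS; apply: ml; rewrite mem_head.
  - exact: measurable_funTS.
  rewrite big_cons polya_law_cons IHl// => Es El.
  by apply: ml; rewrite inE El orbT.
by rewrite int_sum// => Ds /mDs; exact.
Qed.

Lemma polya_law_rcons Cs B : all_measurable Cs -> measurable B ->
  polya_law alpha [::] (rcons Cs B) =
  ((theta + (size Cs)%:R)^-1)%:E *
  (alpha B * polya_law alpha [::] Cs +
   \sum_(Ds <- cap_each Cs B) polya_law alpha [::] Ds).
Proof.
by move=> mCs mB; have [_ ->] := polya_law_induct (erefl (size Cs)) mCs.
Qed.

End polya_predictive_identity.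

(** * Sampling from the limit of the empirical measures *)

Section de_finetti.
Context (R : realType) d (A : measurableType d)
  (alpha : {finite_measure set A -> \bar R})
  d' (Omega : measurableType d') (P : probability Omega R)
  (X : nat -> {RV P >-> A}) (D : {RV P >-> pprobability A R}).
Hypothesis X_polya : polya_sequence alpha X.
Hypothesis D_limit : empirical_limit X D.

Local Notation Dval := (Dval D).

Lemma measurable_Dval C : measurable C -> measurable_fun [set: Omega] (Dval C).
Proof.
move=> mC; apply: measurableT_comp => //.
exact: (measurable_kernel (kprobability (@measurable_funPT _ _ _ _ D)) C mC).
Qed.

Lemma Dval_ge0 C w : 0 <= Dval C w.
Proof. exact: fine_ge0. Qed.

Lemma Dval_le1 C w : measurable C -> Dval C w <= 1.
Proof.
by move=> mC; rewrite -lee_fin fineK ?fin_num_measure//; exact: probability_le1.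
Qed.

Lemma Dval_setT w : Dval [set: A] w = 1.
Proof. by rewrite /Dval probability_setT. Qed.

Definition draw_indic (js : seq nat) (Cs : seq (set A)) (w : Omega) : R :=
  \prod_(p <- zip js Cs) \1_(p.2) (X p.1 w).

Definition Dprod (Bs : seq (set A)) (w : Omega) : R := \prod_(B <- Bs) Dval B w.

Definition rect_prob (Cs : seq (set A)) : R := fine (polya_law alpha [::] Cs).

Lemma draw_indic_rcons js Cs j C w : size js = size Cs ->
  draw_indic (rcons js j) (rcons Cs C) w = draw_indic js Cs w * \1_C (X j w).
Proof.
by move=> E; rewrite /draw_indic zip_rcons// -cats1 big_cat big_seq1.
Qed.

Lemma draw_indic_ge0 js Cs w : 0 <= draw_indic js Cs w.
Proof. by rewrite /draw_indic prodr_ge0// => p _; rewrite indicE. Qed.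

Lemma draw_indic_le1 js Cs w : draw_indic js Cs w <= 1.
Proof.
rewrite /draw_indic prodr_ile1// => p _.
by rewrite indicE ler0n lern1 leq_b1.
Qed.

Lemma Dprod_ge0 Bs w : 0 <= Dprod Bs w.
Proof. by rewrite /Dprod prodr_ge0// => p _; exact: Dval_ge0. Qed.

Lemma all_measurable_in (Bs : seq (set A)) B :
  all_measurable Bs -> B \in Bs -> measurable B.
Proof. by move=> mB /(nthP setT)[i _ <-]. Qed.

Lemma Dprod_le1 Bs w : all_measurable Bs -> Dprod Bs w <= 1.
Proof.
move=> mB; rewrite /Dprod big_seq prodr_ile1// => B /(all_measurable_in mB) mB'.
by rewrite Dval_ge0 Dval_le1.
Qed.

Lemma measurable_draw_indic js Cs : all_measurable Cs ->
  measurable_fun [set: Omega] (draw_indic js Cs).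
Proof.
elim: Cs js => [|C Cs IH] [|j js] mC; try by
  rewrite (_ : draw_indic _ _ = cst 1);
    [exact: measurable_cst|apply/funext => w; rewrite /draw_indic /= big_nil].
have {mC}[mC mCs] := (all_measurable_cons C Cs).1 mC.
rewrite (_ : draw_indic _ _ = fun w => \1_C (X j w) * draw_indic js Cs w);
  last by apply/funext => w; rewrite /draw_indic /= big_cons.
apply: measurable_funM; last exact: IH.
by apply: measurableT_comp => //; exact: measurable_indic.
Qed.

Lemma measurable_Dprod Bs : all_measurable Bs -> measurable_fun [set: Omega] (Dprod Bs).
Proof.
move=> mB; apply: measurable_prod => B /(all_measurable_in mB); exact: measurable_Dval.
Qed.

Lemma Rint_draw_indic js Cs : sorted ltn js -> size js = size Cs -> all_measurable Cs ->
  \int[P]_w draw_indic js Cs w = rect_prob Cs.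
Proof.
move=> sj sjC mC.
(* [polya_sequence] speaks of at least one draw, so the empty product is treated apart. *)
have [C0|Cn0] := posnP (size Cs).
  move: sjC; rewrite C0 => /size0nil ->; move/size0nil : C0 => ->.
  rewrite /rect_prob /= (_ : draw_indic _ _ = cst 1) ?Rint_cst//.
  by apply/funext => w; rewrite /draw_indic big_nil.
pose j (i : 'I_(size Cs)) := nth 0%N js i.
pose B (i : 'I_(size Cs)) := nth setT Cs i.
have mB i : measurable (B i) by exact: mC.
have jmono (i i' : 'I_(size Cs)) : (i < i')%N -> (j i < j i')%N.
  move=> ii; rewrite /j.
  by apply: (sorted_ltn_nth ltn_trans) => //; rewrite inE sjC.
have := X_polya Cn0 jmono mB.
have -> : [seq B i | i : 'I_(size Cs)] = Cs.
  rewrite /image_mem /B (map_comp (nth setT Cs) val) val_enum_ord.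
  exact: mkseq_nth.
rewrite /rect_prob => <-; rewrite -Rint_indic; last first.
  apply: fin_bigcap_measurable => // i _.
  by rewrite -[X in measurable X]setTI; exact: measurable_funPT.
apply: eq_Rintegral => w _.
rewrite /draw_indic (big_nth (0%N, setT)) size_zip sjC minnn big_mkord.
under eq_bigr => i _ do rewrite nth_zip//=.
rewrite indicE; have [/set_mem tE|tE] := boolP (w \in _).
  by rewrite big1// => i _; rewrite indicE mem_set//; exact: tE.
have [i Ei] : exists i : 'I_(size Cs), ~ B i (X (j i) w).
  by apply/existsNP => H; move/negP: tE; apply; apply: mem_set => i _; exact: H.
by rewrite (bigD1 i)//= indicE memNset ?mul0r.
Qed.

(** If e(n) is the mean over the first n draws, the mean over draws M, ..., 2M - 1 is 2 e(2M) -
    e(M). Such a block avoids any given finite set of draws once M is large. *)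
Lemma Dval_block C : measurable C -> {ae P, forall w,
  ((\sum_(i < M) \1_C (X (M + i)%N w)) / M%:R) @[M --> \oo] --> Dval C w}.
Proof.
move=> mC; apply: filterS (D_limit mC) => w cw.
pose e n : R := (\sum_(i < n) \1_C (X i w)) / n%:R.
have ce : e n @[n --> \oo] --> Dval C w by exact: cw.
have c2 : e (M.*2) @[M --> \oo] --> Dval C w.
  apply: (cvg_comp double e _ ce) => S [N _ NS]; exists N => // m Nm.
  by apply: NS; rewrite /= (leq_trans Nm)// -addnn leq_addr.
have -> : (fun M => (\sum_(i < M) \1_C (X (M + i)%N w)) / M%:R) =
  (fun M => 2 * e M.*2 - e M).
  apply/funext => -[|M]; first by rewrite /e !big_ord0 !mul0r mulr0 subr0.
  rewrite /e -addnn big_split_ord/= natrD.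
  have M0 : (M.+1%:R : R) != 0 by rewrite pnatr_eq0.
  have M2 : (M.+1%:R + M.+1%:R : R) != 0 by rewrite -mulr2n mulrn_eq0.
  by field; rewrite -[1 + M%:R]mulrS M0 M2.
rewrite [X in _ --> X](_ : _ = 2 * Dval C w - Dval C w); last by ring.
by apply: cvgB => //; apply: cvgM => //; exact: cvg_cst.
Qed.

(** Replacing D(B) by a block average gives terms with one more draw, later than those of [js]. The
    joint law of draws depends only on their order, so all these terms have the same integral; the
    approximating sequence is eventually constant. *)
Lemma Rint_draw_Dprod js Cs Bs : sorted ltn js -> size js = size Cs ->
  all_measurable Cs -> all_measurable Bs ->
  \int[P]_w (draw_indic js Cs w * Dprod Bs w) = rect_prob (Cs ++ Bs).
Proof.
elim: Bs js Cs => [|B Bs IH] js Cs sj sjC mC mB.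
  rewrite cats0 -(Rint_draw_indic sj)//.
  by apply: eq_Rintegral => w _; rewrite /Dprod big_nil mulr1.
have {mB}[mB mBs] := (all_measurable_cons B Bs).1 mB.
pose blk M w : R := (\sum_(i < M) \1_B (X (M + i)%N w)) / M%:R.
have mblk M : measurable_fun [set: Omega] (blk M).
  apply: measurable_funM => //; apply: measurable_sum => i.
  by apply: measurableT_comp => //; exact: measurable_indic.
have blk01 M w : 0 <= blk M w <= 1.
  rewrite /blk divr_ge0 ?sumr_ge0//=.
  have [->|M0] := posnP M; first by rewrite invr0 mulr0.
  rewrite ler_pdivrMr ?ltr0n// mul1r.
  rewrite -[leRHS](_ : \sum_(i < M) 1 = _); last by rewrite sumr_const card_ord.
  by apply: ler_sum => i _; rewrite indicE lern1 leq_b1.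
have mDB : measurable_fun [set: Omega] (Dprod Bs) by exact: measurable_Dprod.
have mdC : measurable_fun [set: Omega] (draw_indic js Cs).
  exact: measurable_draw_indic.
pose F M w := draw_indic js Cs w * (blk M w * Dprod Bs w).
have F01 M w : 0 <= F M w <= 1.
  have /andP[b0 b1] := blk01 M w.
  have bD0 : 0 <= blk M w * Dprod Bs w by rewrite mulr_ge0 ?Dprod_ge0.
  have bD1 : blk M w * Dprod Bs w <= 1.
    by rewrite mulr_ile1 ?Dprod_ge0 ?Dprod_le1.
  rewrite /F; apply/andP; split; first exact: mulr_ge0 (draw_indic_ge0 _ _ _) bD0.
  by apply: mulr_ile1 => //; [exact: draw_indic_ge0|exact: draw_indic_le1].
have mF M : measurable_fun [set: Omega] (F M).
  by apply: measurable_funM => //; exact: measurable_funM.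
have cF : (\int[P]_w F M w) @[M --> \oo] -->
    \int[P]_w (draw_indic js Cs w * Dprod (B :: Bs) w).
  apply: (proj2 (@Rint_dct _ _ _ P F _ (cst 1) mF _ _ (rint_cst P 1) _)).
  - apply: measurable_funM => //; apply: measurable_Dprod; exact/all_measurable_cons.
  - apply: filterS (Dval_block mB) => w cw.
    rewrite /F {2}/Dprod big_cons; apply: cvgM; first exact: cvg_cst.
    by apply: cvgM; [exact: cw|exact: cvg_cst].
  - by apply: aeW => w M; rewrite ger0_norm; have /andP[] := F01 M w.
have eF : \forall M \near \oo, \int[P]_w F M w = rect_prob (Cs ++ B :: Bs).
  (* Beyond the largest index in [js], appending [M + i] keeps the list strictly increasing; the
     successor also makes [M] positive. *)
  exists (\max_(j <- js) j).+1 => // M /= MJ.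
  have M0 : (0 < M)%N by exact: leq_ltn_trans MJ.
  pose G (i : 'I_M) w :=
    draw_indic (rcons js (M + i)%N) (rcons Cs B) w * Dprod Bs w.
  rewrite (_ : F M = fun w => M%:R^-1 * \sum_(i < M) G i w); last first.
    apply/funext => w; rewrite /F /blk /G.
    under [in RHS]eq_bigr => i _ do rewrite draw_indic_rcons// -mulrA.
    rewrite -mulr_sumr -mulr_suml; ring.
  have mCB : all_measurable (rcons Cs B).
    move=> k; rewrite nth_rcons; case: ifP => // _; case: ifP => // _.
  have iG i : rint P (G i).
    apply: (@rint_bounded _ _ _ _ _ 1).
      by apply: measurable_funM => //; exact: measurable_draw_indic.
    move=> w; rewrite ger0_norm ?mulr_ge0 ?draw_indic_ge0 ?Dprod_ge0//.
    by rewrite mulr_ile1 ?draw_indic_ge0 ?Dprod_ge0 ?draw_indic_le1 ?Dprod_le1//.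
  have [iS ES] := Rint_sum (index_enum 'I_M) iG.
  rewrite RintegralZl// ES.
  under eq_bigr => i _.
    rewrite IH ?cat_rcons ?size_rcons ?sjC//; last first.
      have {}MJ j : j \in js -> (j < M)%N.
        by move=> jjs; apply: leq_ltn_trans MJ; exact: leq_bigmax_seq.
      case: (js) sj MJ => [//|j0 js'] /= sj MJ.
      by rewrite rcons_path sj; apply: ltn_addr; apply: MJ; exact: mem_last.
    over.
  rewrite sumr_const card_ord -[X in _ * X]mulr_natl mulrA mulVf ?mul1r//.
  by rewrite pnatr_eq0 -lt0n.
have cE : (\int[P]_w F M w) @[M --> \oo] --> rect_prob (Cs ++ B :: Bs).
  exact: cvg_near_cst.
exact: (cvg_unique _ cF cE).
Qed.

End de_finetti.

(** * Integration against powers of [D] *)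

Section sampling.
Context (R : realType) d (A : measurableType d)
  (alpha : {finite_measure set A -> \bar R})
  d' (Omega : measurableType d') (P : probability Omega R)
  (X : nat -> {RV P >-> A}) (D : {RV P >-> pprobability A R}).
Hypothesis X_polya : polya_sequence alpha X.
Hypothesis D_limit : empirical_limit X D.

Local Notation Dval := (Dval D).
Local Notation Dprod := (Dprod D).
Local Notation draws := (draws X).
Local Notation Dpow n w := (prob_pow n (Dprob D w)).

Lemma measurable_draws n : measurable_fun [set: Omega] (draws n).
Proof.
apply/measurable_fun_tnthP => i.
rewrite (_ : _ \o _ = X i) //.
by apply/funext => w /=; rewrite tnth_mktuple.
Qed.

Definition law_draws n : probability (n.-tuple A) R :=
  distribution P (HB.pack (draws n)
    (isMeasurableFun.Build _ _ _ _ _ (@measurable_draws n)) : {RV P >-> n.-tuple A}).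

Lemma law_drawsE n B : law_draws n B = P (draws n @^-1` B).
Proof. by []. Qed.

Definition rect_seq n (E : 'I_n -> set A) : seq (set A) := [seq E i | i : 'I_n].

Lemma size_rect_seq n (E : 'I_n -> set A) : size (rect_seq E) = n.
Proof. by rewrite size_map size_enum_ord. Qed.

Lemma nth_rect_seq n (E : 'I_n -> set A) (i : 'I_n) : nth setT (rect_seq E) i = E i.
Proof. by rewrite (nth_map i) ?size_enum_ord// nth_ord_enum. Qed.

Lemma all_measurable_rect_seq n (E : 'I_n -> set A) :
  (forall i, measurable (E i)) -> all_measurable (rect_seq E).
Proof.
move=> mE k; have [kn|nk] := ltnP k n.
  by rewrite (nth_rect_seq E (Ordinal kn)).
by rewrite nth_default// size_rect_seq.
Qed.

Lemma indic_rect_draws n (E : 'I_n -> set A) w :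
  \1_(rect E) (draws n w) = draw_indic X (iota 0 n) (rect_seq E) w.
Proof.
rewrite indic_rect /draw_indic (big_nth (0%N, setT)) size_zip size_iota.
rewrite size_rect_seq minnn big_mkord; apply: eq_bigr => i _.
by rewrite nth_zip ?size_iota ?size_rect_seq//= nth_iota// nth_rect_seq tnth_mktuple.
Qed.

Lemma Dprod_rect_seq n (E : 'I_n -> set A) w :
  Dprod (rect_seq E) w = \prod_(i < n) Dval (E i) w.
Proof. by rewrite /Dprod /rect_seq big_map big_enum. Qed.

Lemma ip_rect_Dprod n (E : 'I_n -> set A) Bs : (forall i, measurable (E i)) ->
  all_measurable Bs -> ip P (\1_(rect E) \o draws n) (Dprod Bs) =
             rect_prob alpha (rect_seq E ++ Bs).
Proof.
move=> mE mB; rewrite -(Rint_draw_Dprod X_polya D_limit (js := iota 0 n))//.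
- by apply: eq_Rintegral => w _; rewrite /= indic_rect_draws.
- exact: iota_ltn_sorted.
- by rewrite size_iota size_rect_seq.
- exact: all_measurable_rect_seq.
Qed.

Lemma rint_Dprod Bs : all_measurable Bs -> rint P (Dprod Bs).
Proof.
move=> mB; apply: (@rint_bounded _ _ _ _ _ 1); first exact: measurable_Dprod.
by move=> w; rewrite ger0_norm ?Dprod_ge0 ?Dprod_le1.
Qed.

(** [Omega] with the sigma-field of [D]: on this type [measurable_wrt] becomes ordinary
    measurability of functions, with its closure properties. *)
Definition sigmaD_type : measurableType _ :=
  g_sigma_algebraType (\bigcup_(C in @measurable _ A)
        preimage_set_system [set: Omega] (Dval C) measurable).

Lemma measurable_wrt_sigmaDE (Y : Omega -> R) :
  measurable_wrt (sigmaD D) Y <-> measurable_fun [set: sigmaD_type] (Y : sigmaD_type -> R).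
Proof.
split=> [mY _ B mB|mY B mB]; first by rewrite setTI; exact: mY.
by have := mY measurableT B mB; rewrite setTI.
Qed.

Lemma sigmaD_measurable : sigmaD D `<=` measurable.
Proof.
apply: smallest_sub; first exact: sigma_algebra_measurable.
move=> _ [C mC [B mB <-]]; exact: measurable_Dval.
Qed.

Lemma measurable_wrt_measurable (Y : Omega -> R) :
  measurable_wrt (sigmaD D) Y -> measurable_fun [set: Omega] Y.
Proof. by move=> mY _ B mB; rewrite setTI; apply: sigmaD_measurable; exact: mY. Qed.

Lemma measurable_Dval_sigmaD C : measurable C ->
  measurable_fun [set: sigmaD_type] (Dval C : sigmaD_type -> R).
Proof.
move=> mC; apply/measurable_wrt_sigmaDE => B mB.
apply: sub_sigma_algebra; exists C => //.
by exists B => //; rewrite setTI.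
Qed.

(** A version of E[g(X_1, ..., X_n) | D]. Where [g] is not integrable for the power of [D] the value
    is a default, so linearity in a square-integrable [g] is only claimed almost surely. *)
Definition sample_mean n (g : n.-tuple A -> R) (w : Omega) : R :=
  \int[Dpow n w]_t g t.

Lemma measurable_Dpow n B : measurable B ->
  measurable_fun [set: sigmaD_type] (fun w : sigmaD_type => Dpow n w B).
Proof.
apply: (@measurable_prob_pow _ A R _ sigmaD_type (Dprob D)).
exact: measurable_Dval_sigmaD.
Qed.

Lemma measurable_ge0_sample_mean n (g : n.-tuple A -> \bar R) :
  measurable_fun [set: n.-tuple A] g -> (forall t, 0 <= g t)%E ->
  measurable_fun [set: sigmaD_type] (fun w : sigmaD_type => \int[Dpow n w]_t g t)%E.
Proof.
move=> mg g0; apply: measurable_fun_integral_kernel => // B mB.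
exact: measurable_Dpow.
Qed.

Lemma measurable_sample_mean n (g : n.-tuple A -> R) :
  measurable_fun [set: n.-tuple A] g -> measurable_wrt (sigmaD D) (sample_mean g).
Proof.
move=> mg; apply/measurable_wrt_sigmaDE.
rewrite /sample_mean /Rintegral.
apply: (measurableT_comp (@fine_measurable R setT measurableT)).
rewrite [X in measurable_fun _ X](_ : _ = (fun w : sigmaD_type =>
    \int[Dpow n w]_t ((EFin \o g)^\+ t) - \int[Dpow n w]_t ((EFin \o g)^\- t))%E);
  last by apply/funext => w; rewrite integralE.
have mg' : measurable_fun [set: n.-tuple A] (EFin \o g) by exact/measurable_EFinP.
apply: emeasurable_funB; apply: measurable_ge0_sample_mean => //.
- exact: measurable_funepos.
- exact: measurable_funeneg.
Qed.

Lemma sample_mean_rect n (E : 'I_n -> set A) w : (forall i, measurable (E i)) ->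
  sample_mean (\1_(rect E)) w = Dprod (rect_seq E) w.
Proof.
move=> mE; rewrite /sample_mean Rint_indic; last exact: measurable_rect.
by rewrite prob_pow_rect// Dprod_rect_seq.
Qed.

(** The mixture of the powers of [D] is the law of the draws. Written as a bind of kernels it is a
    measure, so comparison on rectangles suffices; there [Rint_draw_Dprod] without any draw gives
    the value. *)
Lemma integral_sample_mean n (g : n.-tuple A -> \bar R) :
  measurable_fun [set: n.-tuple A] g -> (forall t, 0 <= g t)%E ->
  (\int[P]_w \int[Dpow n w]_t g t = \int[law_draws n]_t g t)%E.
Proof.
move=> mg g0.
have mf : measurable_fun [set: Omega] (fun w => Dpow n w : giry (n.-tuple A) R).
  apply: measurable_giry_codensity => // B mB.
  apply: measurable_prob_pow => //; exact: measurable_Dval.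
have := giry_int_bind (P : giry Omega R) mf mg g0.
rewrite /giry_int => <-.
apply: eq_measure_integral => B mB _.
have bindE B' : measurable B' ->
    giry_bind (P : giry Omega R) mf B' = (\int[P]_w Dpow n w B')%E.
  move=> mB'.
  have m1 : measurable_fun [set: n.-tuple A] (fun t => (\1_B' t : R)%:E).
    by apply/measurable_EFinP; exact: measurable_indic.
  have i0 t : (0 <= (\1_B' t : R)%:E)%E by rewrite lee_fin indicE.
  have := giry_int_bind (P : giry Omega R) mf m1 i0.
  rewrite /giry_int integral_indic// setIT => ->.
  by apply: eq_integral => w _; rewrite integral_indic// setIT.
apply/esym; apply: rects_measure_unique => // E mE.
rewrite [RHS]bindE; last exact: measurable_rect.
have mEs := all_measurable_rect_seq mE.
have Ei : rint P (Dprod (rect_seq E)) by exact: rint_Dprod.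
transitivity (\int[P]_w Dprod (rect_seq E) w)%:E; last first.
  rewrite /Rintegral fineK; last exact: (integrable_fin_num measurableT Ei).
  apply: eq_integral => w _; rewrite prob_pow_rect//.
  by rewrite Dprod_rect_seq.
have -> : \int[P]_w Dprod (rect_seq E) w = rect_prob alpha (rect_seq E).
  have := Rint_draw_Dprod X_polya D_limit (js := [::]) (Cs := [::]) isT erefl
    (fun k => _) mEs.
  rewrite -[rect_seq E in RHS]cat0s => <-.
    by apply: eq_Rintegral => w _; rewrite /draw_indic big_nil mul1r.
  by move=> k; rewrite nth_nil.
rewrite law_drawsE -[LHS]fineK ?fin_num_measure//; last first.
  rewrite -[X in measurable X]setTI; apply: measurable_draws => //.
  exact: measurable_rect.
congr EFin; rewrite -Rint_indic; last first.
  rewrite -[X in measurable X]setTI; apply: measurable_draws => //.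
  exact: measurable_rect.
rewrite -(Rint_draw_indic X_polya (js := iota 0 n))//.
- by apply: eq_Rintegral => w _; rewrite -indic_rect_draws.
- exact: iota_ltn_sorted.
- by rewrite size_iota size_rect_seq.
Qed.

Lemma ae_L2_Dpow n (g : n.-tuple A -> R) : L2 (law_draws n) g ->
  {ae P, forall w, L2 (Dpow n w) g}.
Proof.
move=> g2; have mg2 : measurable_fun [set: n.-tuple A] (fun t => (g t ^+ 2)%:E).
  by apply/measurable_EFinP; apply: measurable_funX; exact: g2.1.
have g20 t : (0 <= (g t ^+ 2)%:E)%E by rewrite lee_fin sqr_ge0.
have iP : P.-integrable [set: Omega] (fun w => \int[Dpow n w]_t (g t ^+ 2)%:E)%E.
  apply/integrableP; split.
    apply: measurable_fun_integral_kernel => // B mB.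
    by apply: measurable_prob_pow => //; exact: measurable_Dval.
  under eq_integral do rewrite gee0_abs ?integral_ge0//.
  rewrite integral_sample_mean//.
  have /integrableP[_] := g2.2.
  by under eq_integral do rewrite /= ger0_norm ?sqr_ge0//.
have := integrable_ae measurableT iP.
apply: filterS => w /(_ I) wf; split; first exact: g2.1.
apply/integrableP; split; first exact: mg2.
under eq_integral do rewrite /= ger0_norm ?sqr_ge0//.
by rewrite ltey_eq wf.
Qed.

Lemma L2_Dprod Bs : all_measurable Bs -> L2 P (Dprod Bs).
Proof.
move=> mB; apply: (@L2_bounded _ _ _ _ _ 1); first exact: measurable_Dprod.
by move=> w; rewrite ger0_norm ?Dprod_ge0 ?Dprod_le1.
Qed.

(** Cauchy-Schwarz against the constant 1 inside each power of [D], followed by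
    [integral_sample_mean]. *)
Lemma sample_mean_contraction n (g : n.-tuple A -> R) : L2 (law_draws n) g ->
  L2 P (sample_mean g) /\
  ip P (sample_mean g) (sample_mean g) <= ip (law_draws n) g g.
Proof.
move=> g2.
have mTg : measurable_fun [set: Omega] (sample_mean g).
  by apply: measurable_wrt_measurable; apply: measurable_sample_mean; exact: g2.1.
have mg2 : measurable_fun [set: n.-tuple A] (fun t => (g t ^+ 2)%:E).
  by apply/measurable_EFinP; apply: measurable_funX; exact: g2.1.
have g20 t : (0 <= (g t ^+ 2)%:E)%E by rewrite lee_fin sqr_ge0.
have ipE : (\int[law_draws n]_t (g t ^+ 2)%:E = (ip (law_draws n) g g)%:E)%E.
  rewrite /ip /Rintegral fineK; last exact: (integrable_fin_num _ (L2M g2 g2)).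
  by under [RHS]eq_integral do rewrite -expr2.
have le2 : (\int[P]_w (sample_mean g w ^+ 2)%:E <= (ip (law_draws n) g g)%:E)%E.
  rewrite -ipE -integral_sample_mean//.
  apply: ge0_le_integral => //.
  - by move=> w _; rewrite lee_fin sqr_ge0.
  - by apply/measurable_EFinP; exact: measurable_funX.
  - apply: measurable_fun_integral_kernel => // B mB.
    by apply: measurable_prob_pow => //; exact: measurable_Dval.
  (* Where the second moment is infinite the bound is void, so the comparison holds at every
     point. *)
  - move=> w _; have [gy|gfin] := eqVneq (\int[Dpow n w]_t (g t ^+ 2)%:E)%E +oo%E.
      by rewrite gy leey.
    have gw : L2 (Dpow n w) g.
      split; first exact: g2.1.
      apply/integrableP; split; first exact: mg2.
      under eq_integral do rewrite /= ger0_norm ?sqr_ge0//.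
      by rewrite lt_neqAle gfin leey.
    have := ip_CS gw (L2_cst _ 1).
    have -> : ip (Dpow n w) (cst 1) (cst 1) = 1.
      by rewrite /ip; under eq_Rintegral do rewrite mulr1; rewrite Rint_cst.
    have -> : ip (Dpow n w) g (cst 1) = sample_mean g w.
      by rewrite /ip; under eq_Rintegral do rewrite mulr1.
    rewrite mulr1 -lee_fin => /le_trans; apply.
    rewrite /ip /Rintegral fineK; last exact: (integrable_fin_num _ (L2M gw gw)).
    by under eq_integral do rewrite -expr2.
have Tg2 : L2 P (sample_mean g).
  apply/L2E => //; rewrite unlock; apply: (le_lt_trans le2); exact: ltry.
split => //; rewrite -lee_fin; apply: le_trans le2.
rewrite /ip /Rintegral fineK; last exact: (integrable_fin_num _ (L2M Tg2 Tg2)).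
by under eq_integral do rewrite -expr2.
Qed.

Lemma sample_meanZD n a (g h : n.-tuple A -> R) :
  L2 (law_draws n) g -> L2 (law_draws n) h ->
  {ae P, forall w,
     sample_mean (fun t => a * g t + h t) w = a * sample_mean g w + sample_mean h w}.
Proof.
move=> g2 h2; apply: filterS2 (ae_L2_Dpow g2) (ae_L2_Dpow h2) => w gw hw.
by rewrite /sample_mean Rint_ZD//; exact: L2_rint.
Qed.

(** The defining property of E[g(X) | D], tested on monomials. The monotone class theorem reduces it
    to indicators of rectangles, where both sides are [rect_prob alpha (rect_seq E ++ Bs)]. *)
Lemma ip_sample_mean n (g : n.-tuple A -> R) Bs : L2 (law_draws n) g -> all_measurable Bs ->
  ip P (sample_mean g) (Dprod Bs) = ip P (g \o draws n) (Dprod Bs).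
Proof.
move=> g2 mB; have B2 := L2_Dprod mB.
have TL f : L2 (law_draws n) f -> L2 P (sample_mean f).
  by move=> /sample_mean_contraction[].
have XL f : L2 (law_draws n) f -> L2 P (f \o draws n).
  by move=> f2; apply/(L2_law (@measurable_draws n) (fun B _ => law_drawsE B) f2.1).
pose H : set (n.-tuple A -> R) :=
  [set f | ip P (sample_mean f) (Dprod Bs) = ip P (f \o draws n) (Dprod Bs)].
suff : H g by [].
apply: (@functional_monotone_class _ _ R (@rects _ A n) (L2 (law_draws n)) H) => //;
  last exact: g2.1.
- exact: measurable_rectsE.
- exact: rects_setI.
- exact: rects_setT.
- exact: L2_cst.
- by move=> v1 v2 H1 m2 H2; exact: L2_le H1 m2 H2.
- move=> _ [E mE ->]; rewrite /H /mkset ip_rect_Dprod//.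
  have <- := Rint_draw_Dprod X_polya D_limit (js := [::]) (Cs := [::]) isT erefl
    (fun k => _) (_ : all_measurable (rect_seq E ++ Bs)).
  + apply: eq_Rintegral => w _.
    by rewrite /draw_indic big_nil mul1r sample_mean_rect// /Dprod big_cat.
  + by move=> k; rewrite nth_nil.
  + move=> k; rewrite nth_cat; case: ifP => // _; exact: all_measurable_rect_seq.
- move=> a f1 f2 m1 m2 H1 H2; rewrite /H /mkset => E1 E2.
  have F1 := TL _ H1; have F2 := TL _ H2.
  rewrite (eq_ae_ip _ _ B2 (sample_meanZD a H1 H2)); last 2 first.
  + by apply: TL; exact: L2ZD.
  + exact: L2ZD.
  rewrite (_ : _ \o draws n = fun w => a * (f1 \o draws n) w + (f2 \o draws n) w)//.
  by rewrite !ipZD ?E1 ?E2//; exact: XL.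
- move=> F f mF HF mf f2 Fle Ff; rewrite /H /mkset.
  have F2 k : L2 (law_draws n) (F k) by exact: L2_le f2 (mF k) (Fle k).
  have c1 : ip P (F k \o draws n) (Dprod Bs) @[k --> \oo] -->
            ip P (f \o draws n) (Dprod Bs).
    apply: ip_dct => //.
    + by move=> k; exact: (XL _ (F2 k)).1.
    + exact: XL.
    + by move=> w; exact: Ff.
    + by move=> k w; exact: Fle.
  (* Dominated convergence is used twice: under almost every power of [D] with bound |f|, then under
     [P] with the sample mean of |f| as bound, since monomials take values in [0, 1]. *)
  have c2 : ip P (sample_mean (F k)) (Dprod Bs) @[k --> \oo] -->
            ip P (sample_mean f) (Dprod Bs).
    have nf2 : L2 (law_draws n) (fun t => `|f t|).
      by apply: L2_le f2 _ _; [exact: measurableT_comp|move=> t; rewrite normr_id].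
    apply: (proj2 (@Rint_dct _ _ _ P (fun k w => sample_mean (F k) w * Dprod Bs w)
      (fun w => sample_mean f w * Dprod Bs w) (sample_mean (fun t => `|f t|)) _ _ _ _ _)).
    + by move=> k; apply: measurable_funM; [exact: (TL _ (F2 k)).1|exact: B2.1].
    + by apply: measurable_funM; [exact: (TL _ f2).1|exact: B2.1].
    + apply: filterS (ae_L2_Dpow f2) => w fw; apply: cvgM; last exact: cvg_cst.
      apply: (proj2 (@Rint_dct _ _ _ (Dpow n w) F f (fun t => `|f t|) mF mf _ _ _)).
      * by apply: aeW => t; exact: Ff.
      * exact: (integrable_norm (L2_rint fw)).
      * by apply: aeW => t k; exact: Fle.
    + exact: (L2_rint (TL _ nf2)).
    + apply: filterS (ae_L2_Dpow f2) => w fw k.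
      have fi : rint (Dpow n w) (fun t => `|f t|).
        exact: (integrable_norm (L2_rint fw)).
      have Fi : rint (Dpow n w) (F k) by exact: L2_rint (L2_le fw (mF k) (Fle k)).
      rewrite normrM (@ger0_norm _ (Dprod _ _)) ?Dprod_ge0//.
      apply: (@le_trans _ _ `|sample_mean (F k) w|).
        by rewrite ler_piMr ?Dprod_le1.
      apply: (le_trans (le_normr_Rintegral measurableT Fi)).
      apply: le_Rintegral => //; first exact: (integrable_norm Fi).
  have E : (fun k => ip P (sample_mean (F k)) (Dprod Bs)) =
           (fun k => ip P (F k \o draws n) (Dprod Bs)).
    by apply/funext => k; exact: HF.
  by rewrite E in c2; exact: (cvg_unique _ c2 c1).
Qed.

End sampling.

(** * Posterior means of monomials *)

Section posterior_expansion.
Context (R : realType) d (A : measurableType d)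
  (alpha : {finite_measure set A -> \bar R})
  d' (Omega : measurableType d') (P : probability Omega R)
  (X : nat -> {RV P >-> A}) (D : {RV P >-> pprobability A R}).
Hypothesis alpha_gt0 : (0 < alpha [set: A])%E.
Hypothesis X_polya : polya_sequence alpha X.
Hypothesis D_limit : empirical_limit X D.

Local Notation Dval := (Dval D).
Local Notation Dprod := (Dprod D).
Local Notation draws := (draws X).
Local Notation Dpow n w := (prob_pow n (Dprob D w)).
Local Notation T := (sample_mean D).
Local Notation theta := (fine (alpha [set: A])).
Local Notation rect_prob := (rect_prob alpha).

(* Polynomials in the [Dval C] of degree strictly less than [m]: [Dpoly 0] is {0}. *)
Inductive Dpoly m : (Omega -> R) -> Prop :=
| Dpoly0 : Dpoly m (cst 0)
| DpolyS a Bs Z : all_measurable Bs -> (size Bs < m)%N -> Dpoly m Z ->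
    Dpoly m (fun w => a * Dprod Bs w + Z w).

Lemma DpolyZD m a Z1 Z2 : Dpoly m Z1 -> Dpoly m Z2 ->
  Dpoly m (fun w => a * Z1 w + Z2 w).
Proof.
move=> p1 p2; elim: p1 => [|b Bs Z mB sB pZ IH].
  by under eq_fun do rewrite mulr0 add0r.
under eq_fun do rewrite mulrDr -addrA mulrA.
exact: DpolyS.
Qed.

Lemma DpolyD m Z1 Z2 : Dpoly m Z1 -> Dpoly m Z2 -> Dpoly m (fun w => Z1 w + Z2 w).
Proof.
by move=> p1 p2; have := DpolyZD 1 p1 p2; under eq_fun do rewrite mul1r.
Qed.

Lemma DpolyZ m a Z : Dpoly m Z -> Dpoly m (fun w => a * Z w).
Proof.
by move=> p1; have := DpolyZD a p1 (Dpoly0 m); under eq_fun do rewrite addr0.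
Qed.

Lemma Dpoly_Dprod m Bs : all_measurable Bs -> (size Bs < m)%N -> Dpoly m (Dprod Bs).
Proof.
move=> mB sB; have := DpolyS 1 mB sB (Dpoly0 m).
by under eq_fun do rewrite mul1r addr0.
Qed.

Lemma Dpoly_sum m (I : Type) (s : seq I) (F : I -> Omega -> R) :
  (forall i, Dpoly m (F i)) -> Dpoly m (fun w => \sum_(i <- s) F i w).
Proof.
move=> pF; elim: s => [|i s IH].
  by under eq_fun do rewrite big_nil; exact: Dpoly0.
by under eq_fun do rewrite big_cons; exact: DpolyD.
Qed.

Lemma Dpoly_widen m m' Z : (m <= m')%N -> Dpoly m Z -> Dpoly m' Z.
Proof.
move=> mm; elim=> [|a Bs {}Z mB sB _ IH]; first exact: Dpoly0.
by apply: DpolyS => //; exact: leq_trans mm.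
Qed.

Lemma Dpoly_Dval m B Z : measurable B -> Dpoly m Z ->
  Dpoly m.+1 (fun w => Dval B w * Z w).
Proof.
move=> mB; elim=> [|a Bs {}Z mBs sB _ IH].
  by under eq_fun do rewrite mulr0; exact: Dpoly0.
rewrite (_ : (fun w => _) =
    (fun w => a * Dprod (B :: Bs) w + Dval B w * Z w)); last first.
  by apply/funext => w; rewrite /Dprod big_cons; ring.
by apply: DpolyS => //; exact/all_measurable_cons.
Qed.

Lemma Dpoly_L2 m Z : Dpoly m Z -> L2 P Z.
Proof.
elim=> [|a Bs {}Z mB _ _ IH]; first exact: L2_cst.
by apply: L2ZD => //; exact: L2_Dprod.
Qed.

Lemma Dpoly_measurable m Z : Dpoly m Z -> measurable_wrt (sigmaD D) Z.
Proof.
move=> pZ; apply/measurable_wrt_sigmaDE; elim: pZ => [|a Bs {}Z mB _ _ IH].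
  exact: measurable_cst.
apply: measurable_funD => //; apply: measurable_funM; first exact: measurable_cst.
by apply: measurable_prod => B /(all_measurable_in mB); exact: measurable_Dval_sigmaD.
Qed.

(* Linear combinations of indicators of rectangles that constrain at most [m]
   of the [n] coordinates, namely those in [S]. *)
Inductive rect_span n m : (n.-tuple A -> R) -> Prop :=
| rect_span0 : rect_span m (cst 0)
| rect_spanS a (E : 'I_n -> set A) (S : {set 'I_n}) u : (forall i, measurable (E i)) ->
    (forall i, i \notin S -> E i = setT) -> (#|S| <= m)%N -> rect_span m u ->
    rect_span m (fun t => a * \1_(rect E) t + u t).

Lemma rect_spanZD n m a (u v : n.-tuple A -> R) : rect_span m u -> rect_span m v ->
  rect_span m (fun t => a * u t + v t).
Proof.
move=> p1 p2; elim: p1 => [|b E S {}u mE ES sS _ IH].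
  by under eq_fun do rewrite mulr0 add0r.
under eq_fun do rewrite mulrDr -addrA mulrA.
exact: (rect_spanS _ mE ES sS IH).
Qed.

Lemma rect_spanD n m (u v : n.-tuple A -> R) : rect_span m u -> rect_span m v ->
  rect_span m (fun t => u t + v t).
Proof.
by move=> p1 p2; have := rect_spanZD 1 p1 p2; under eq_fun do rewrite mul1r.
Qed.

Lemma rect_spanZ n m a (u : n.-tuple A -> R) : rect_span m u -> rect_span m (fun t => a * u t).
Proof.
by move=> p1; have := rect_spanZD a p1 (rect_span0 n m); under eq_fun do rewrite addr0.
Qed.

Lemma rect_span_sum n m (I : Type) (s : seq I) (F : I -> n.-tuple A -> R) :
  (forall i, rect_span m (F i)) -> rect_span m (fun w => \sum_(i <- s) F i w).
Proof.
move=> pF; elim: s => [|i s IH].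
  by under eq_fun do rewrite big_nil; exact: rect_span0.
by under eq_fun do rewrite big_cons; exact: rect_spanD.
Qed.

Lemma rect_span_widen n m m' (u : n.-tuple A -> R) : 
  (m <= m')%N -> rect_span m u -> rect_span m' u.
Proof.
move=> mm; elim=> [|a E S {}u mE ES sS _ IH]; first exact: rect_span0.
exact: (rect_spanS _ mE ES (leq_trans sS mm) IH).
Qed.

Lemma rect_span_bounded n m (u : n.-tuple A -> R) : rect_span m u ->
  measurable_fun [set: n.-tuple A] u /\ exists M, forall t, `|u t| <= M.
Proof.
elim=> [|a E S {}u mE _ _ _ [mu [M uM]]].
  by split; [exact: measurable_cst|exists 0 => t; rewrite normr0].
split.
  apply: measurable_funD => //; apply: measurable_funM; first exact: measurable_cst.
  by apply: measurable_indic; exact: measurable_rect.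
exists (`|a| + M) => t; rewrite (le_trans (ler_normD _ _))// lerD//.
by rewrite normrM ler_piMr// indicE ger0_norm// lern1 leq_b1.
Qed.

Lemma rect_span_L2 n m (u : n.-tuple A -> R) (mu : probability (n.-tuple A) R) :
  rect_span m u -> L2 mu u.
Proof. by move=> /rect_span_bounded[mu' [M uM]]; exact: L2_bounded uM. Qed.

Lemma sample_mean_spanZD n m a (u v : n.-tuple A -> R) w : rect_span m u -> rect_span m v ->
  T (fun t => a * u t + v t) w = a * T u w + T v w.
Proof.
move=> su sv; rewrite /sample_mean Rint_ZD//; apply: L2_rint.
  exact: (rect_span_L2 _ su).
exact: (rect_span_L2 _ sv).
Qed.

Lemma sample_mean_spanD n m (u v : n.-tuple A -> R) w : rect_span m u -> rect_span m v ->
  T (fun t => u t + v t) w = T u w + T v w.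
Proof.
by move=> su sv; rewrite -[T u w]mul1r -(sample_mean_spanZD 1 w su sv);
  under [in RHS]eq_fun do rewrite mul1r.
Qed.

Lemma sample_mean_span_sum n m (I : Type) (s : seq I) (F : I -> n.-tuple A -> R) w :
  (forall i, rect_span m (F i)) ->
  T (fun t => \sum_(i <- s) F i t) w = \sum_(i <- s) T (F i) w.
Proof.
move=> sF; elim: s => [|i s IH].
  under eq_fun do rewrite big_nil.
  by rewrite big_nil /sample_mean Rint_cst.
under eq_fun do rewrite big_cons.
by rewrite big_cons (sample_mean_spanD _ (sF i) (rect_span_sum s sF)) IH.
Qed.

(** The counterpart of [cap_each] for families indexed by coordinates: [i] is the draw that gets
    copied. *)
Definition cap1 n (E : 'I_n -> set A) (i : 'I_n) (B : set A) : 'I_n -> set A :=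
  fun j => if j == i then E j `&` B else E j.

Lemma measurable_cap1 n (E : 'I_n -> set A) i B : (forall j, measurable (E j)) ->
  measurable B -> forall j, measurable (cap1 E i B j).
Proof. by move=> mE mB j; rewrite /cap1; case: ifP => // _; exact: measurableI. Qed.

Lemma indic_cap1 n (E : 'I_n -> set A) i B t :
  \1_B (tnth t i) * \1_(rect E) t = \1_(rect (cap1 E i B)) t :> R.
Proof.
rewrite !indicE -natrM mulnb; congr (nat_of_bool _)%:R.
apply/andP/idP => [[/set_mem Bt /set_mem Et]|/set_mem H].
  by apply: mem_set => j; rewrite /cap1; case: ifP => [/eqP ->|_]; [split|]; try exact: Et.
split; apply: mem_set; last first.
  by move=> j; have := H j; rewrite /cap1; case: ifP => // _ [].
by have := H i; rewrite /cap1 eqxx => -[].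
Qed.

Lemma Dprod_rect_supp n (E : 'I_n -> set A) (S : {set 'I_n}) w :
  (forall i, i \notin S -> E i = setT) ->
  Dprod (rect_seq E) w = Dprod [seq E i | i <- enum S] w.
Proof.
move=> ES; rewrite Dprod_rect_seq /Dprod big_map big_enum /=.
rewrite (bigID (mem S))/= mulrC big1 ?mul1r// => i iS.
by rewrite ES// Dval_setT.
Qed.

(** A coordinate outside [S] contributes the factor D(A) = 1. *)
Lemma Dpoly_rect n (E : 'I_n -> set A) (S : {set 'I_n}) m :
  (forall i, measurable (E i)) -> (forall i, i \notin S -> E i = setT) ->
  (#|S| < m)%N -> Dpoly m (Dprod (rect_seq E)).
Proof.
move=> mE ES sS; rewrite (funext (fun w => Dprod_rect_supp w ES)).
apply: Dpoly_Dprod; last by rewrite size_map -cardE.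
move=> k; have [kS|kS] := ltnP k #|S|; last first.
  by rewrite nth_default// size_map -cardE.
by have [i0 _] := card_gt0P (leq_ltn_trans (leq0n _) kS); rewrite (nth_map i0) -?cardE.
Qed.

Lemma sample_mean_span_Dpoly n m (u : n.-tuple A -> R) : rect_span m u -> Dpoly m.+1 (T u).
Proof.
elim=> [|a E S {}u mE ES sS su IH].
  rewrite [X in Dpoly _ X](_ : _ = cst 0); first exact: Dpoly0.
  by apply/funext => w; rewrite /sample_mean Rint_cst.
have s1E : rect_span m (\1_(rect E)).
  have := rect_spanS 1 mE ES sS (rect_span0 n m).
  by under eq_fun do rewrite mul1r addr0.
rewrite (funext (fun w => sample_mean_spanZD a w s1E su)).
rewrite (funext (fun w => congr2 _ (congr1 _ (sample_mean_rect D w mE)) erefl)).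
by apply: DpolyZD => //; exact: (Dpoly_rect mE ES).
Qed.

Lemma rect_span_cap n m (u : n.-tuple A -> R) i B : measurable B -> rect_span m u ->
  rect_span m.+1 (fun t => \1_B (tnth t i) * u t).
Proof.
move=> mB; elim=> [|a E S {}u mE ES sS _ IH].
  by under eq_fun do rewrite mulr0; exact: rect_span0.
rewrite (_ : (fun t => _) =
  (fun t => a * \1_(rect (cap1 E i B)) t + \1_B (tnth t i) * u t)); last first.
  by apply/funext => t; rewrite -indic_cap1; ring.
apply: (@rect_spanS _ _ _ _ (i |: S)) => //.
- exact: measurable_cap1.
- move=> j; rewrite !inE negb_or /cap1 => /andP[/negbTE -> jS]; exact: ES.
- by rewrite cardsU1 (leq_trans (leq_add (leq_b1 _) sS)).
Qed.

(** For one rectangle with constrained set [S]: imposing [B] on a coordinate of [S] refines an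
    existing factor and leaves the degree at most m, while each of the n - #|S| other coordinates
    produces a new factor D(B). Writing n - m instead of n - #|S| costs (m - #|S|) D(B) times a
    monomial of degree #|S|, which is 0 or of degree at most m. *)
Lemma sample_mean_span_mid n m (u : n.-tuple A -> R) B : measurable B -> rect_span m u ->
  Dpoly m.+1 (fun w => T (fun t => \sum_(i < n) (\1_B (tnth t i) * u t)) w -
                    (n%:R - m%:R) * (Dval B w * T u w)).
Proof.
move=> mB; elim=> [|a E S {}u mE ES sS su IH].
  rewrite [X in Dpoly _ X](_ : _ = cst 0); first exact: Dpoly0.
  apply/funext => w; rewrite [X in T X w](_ : _ = cst 0); last first.
    by apply/funext => t; rewrite big1// => i _; rewrite mulr0.
  by rewrite /sample_mean !Rint_cst !mulr0 subr0.
have sE : rect_span m (fun t => a * \1_(rect E) t).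
  by have := rect_spanS a mE ES sS (rect_span0 n m); under eq_fun do rewrite addr0.
have s1E : rect_span m (\1_(rect E)).
  have := rect_spanS 1 mE ES sS (rect_span0 n m).
  by under eq_fun do rewrite mul1r addr0.
pose q w := T (fun t => \sum_(i < n) (\1_B (tnth t i) * \1_(rect E) t)) w -
                    (n%:R - m%:R) * (Dval B w * T (\1_(rect E)) w).
rewrite [X in Dpoly _ X](_ : _ = fun w => a * q w +
  (T (fun t => \sum_(i < n) (\1_B (tnth t i) * u t)) w -
                    (n%:R - m%:R) * (Dval B w * T u w))); last first.
  apply/funext => w; rewrite (sample_mean_spanZD _ _ s1E su).
  rewrite [X in T X w](_ : _ = (fun t =>
    a * (\sum_(i < n) (\1_B (tnth t i) * \1_(rect E) t)) +
    (\sum_(i < n) (\1_B (tnth t i) * u t)))); last first.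
    apply/funext => t; rewrite mulr_sumr -big_split/=.
    by apply: eq_bigr => i _; ring.
  rewrite (@sample_mean_spanZD _ m.+1); last 2 first.
  - by apply: rect_span_sum => i; exact: rect_span_cap.
  - by apply: rect_span_sum => i; exact: rect_span_cap.
  by rewrite /q; ring.
apply: DpolyZD => //; rewrite /q {IH q}.
pose F i := Dprod (rect_seq (cap1 E i B)).
rewrite [X in Dpoly _ X](_ : _ = (fun w => \sum_(i in S) F i w +
    (m%:R - #|S|%:R) * (Dval B w * Dprod (rect_seq E) w))); last first.
  apply/funext => w; rewrite (@sample_mean_span_sum _ m.+1); last by move=> i; exact: rect_span_cap.
  rewrite sample_mean_rect//.
  rewrite (bigID (mem S))/=.
  rewrite (eq_bigr (F ^~ w)); last first.
    move=> i _; rewrite (funext (indic_cap1 E i B)) sample_mean_rect//.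
    exact: measurable_cap1.
  rewrite [X in _ + X - _](eq_bigr (fun=> Dval B w * Dprod (rect_seq E) w)); last first.
    move=> i iS; rewrite (funext (indic_cap1 E i B)) sample_mean_rect//; last first.
      exact: measurable_cap1.
    rewrite !Dprod_rect_seq (bigD1 i)//= [in RHS](bigD1 i)//= /cap1 eqxx ES// setTI.
    rewrite Dval_setT mul1r; congr (_ * _).
    by apply: eq_bigr => j /negbTE ->.
  rewrite sumr_const.
  have -> : #|[predC (mem S)]| = (n - #|S|)%N.
    by have /(canRL (addKn _)) := cardC (mem S); rewrite card_ord.
  rewrite -[_ *+ (n - _)]mulr_natl natrB; last by rewrite -[X in (_ <= X)%N]card_ord max_card.
  by ring.
apply: DpolyD.
  have pF i : i \in S -> Dpoly m.+1 (F i).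
    move=> iS; apply: (@Dpoly_rect _ _ S) => //; first exact: measurable_cap1.
    by move=> j jS; rewrite /cap1; case: ifPn jS => [/eqP ->|_ /ES//]; rewrite iS.
  rewrite [X in Dpoly _ X](_ : _ =
    (fun w => \sum_(i < n) (if i \in S then F i else cst 0) w)); last first.
    by apply/funext => w; rewrite big_mkcond; apply: eq_bigr => i _; case: ifP.
  apply: Dpoly_sum => i; case: ifP => [/pF //|_]; exact: Dpoly0.
have [Sm|Sm] := ltnP #|S| m.
  by apply: DpolyZ; apply: Dpoly_Dval => //; exact: (Dpoly_rect mE ES Sm).
have -> : m = #|S| by apply/eqP; rewrite eqn_leq Sm sS.
under eq_fun do rewrite subrr mul0r; exact: Dpoly0.
Qed.

Lemma polya_law_fin Cs : all_measurable Cs -> polya_law alpha [::] Cs = (rect_prob Cs)%:E.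
Proof.
move=> mC; rewrite /rect_prob.
have [C0|Cn0] := posnP (size Cs); first by move/size0nil : C0 => ->.
pose B (i : 'I_(size Cs)) := nth setT Cs i.
have := @X_polya (size Cs) (fun i => i) B Cn0 (fun i i' ii => ii) (fun i => mC i).
have -> : [seq B i | i : 'I_(size Cs)] = Cs.
  rewrite /image_mem /B (map_comp (nth setT Cs) val) val_enum_ord.
  exact: mkseq_nth.
move=> <-; rewrite fineK// fin_num_measure//.
apply: fin_bigcap_measurable => // i _.
rewrite -[X in measurable X]setTI; apply: measurable_funPT => //; exact: mC.
Qed.

Lemma theta_gt0 : 0 < theta.
Proof. by rewrite fine_gt0// alpha_gt0 ltey_eq fin_num_measure. Qed.

Lemma rect_prob_rcons Cs B : all_measurable Cs -> measurable B ->
  rect_prob (rcons Cs B) = (theta + (size Cs)%:R)^-1 *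
    (fine (alpha B) * rect_prob Cs + \sum_(Ds <- cap_each Cs B) rect_prob Ds).
Proof.
move=> mC mB.
have mCB : all_measurable (rcons Cs B).
  by move=> k; rewrite nth_rcons; case: ifP => // _; case: ifP.
have := polya_law_rcons alpha mC mB.
rewrite !polya_law_fin// big_seq.
rewrite (eq_bigr (fun Ds => (rect_prob Ds)%:E)); last first.
  by move=> Ds /(cap_each_measurable mB mC)[_ mD]; rewrite polya_law_fin.
rewrite -big_seq sumEFin -(@fineK _ (alpha B)) ?fin_num_measure//.
by move=> [].
Qed.

Lemma cap_each_cat (s1 s2 : seq (set A)) B : cap_each (s1 ++ s2) B =
  [seq Ds ++ s2 | Ds <- cap_each s1 B] ++ [seq s1 ++ Ds | Ds <- cap_each s2 B].
Proof.
elim: s1 => [|C s1 IH] /=; first by rewrite map_id.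
by rewrite IH map_cat -!map_comp.
Qed.

Lemma cap_each_mkseq (Cs : seq (set A)) B : cap_each Cs B =
  mkseq (fun k => set_nth setT Cs k (nth setT Cs k `&` B)) (size Cs).
Proof.
elim: Cs => [//|C Cs IH] /=; rewrite IH /mkseq /= -map_comp; congr (_ :: _).
by rewrite -[1%N]addn0 iotaDl -map_comp.
Qed.

Lemma sum_cap_each_rect n (E : 'I_n -> set A) B (f : seq (set A) -> R) :
  \sum_(Ds <- cap_each (rect_seq E) B) f Ds =
  \sum_(i < n) f (rect_seq (cap1 E i B)).
Proof.
rewrite cap_each_mkseq size_rect_seq /mkseq big_map -[n in iota 0 n]subn0.
rewrite big_mkord; apply: eq_bigr => i _; congr f.
apply: (@eq_from_nth _ setT).
  by rewrite size_set_nth !size_rect_seq; apply/maxn_idPr.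
move=> k; rewrite size_set_nth size_rect_seq (maxn_idPr (ltn_ord i)) => kn.
rewrite nth_set_nth /= (nth_rect_seq (cap1 E i B) (Ordinal kn)) /cap1.
rewrite (_ : (Ordinal kn == i) = (k == i :> nat))//.
case: eqP => [ki|_]; last by rewrite (nth_rect_seq E (Ordinal kn)).
by rewrite nth_rect_seq (_ : Ordinal kn = i)//; exact/val_inj.
Qed.

Lemma ip_rect_capped n (E : 'I_n -> set A) i B (u : n.-tuple A -> R) :
  ip P (\1_(rect E) \o draws n) ((fun t => \1_B (tnth t i) * u t) \o draws n) =
  ip P (\1_(rect (cap1 E i B)) \o draws n) (u \o draws n) :> R.
Proof.
by apply: eq_Rintegral => w _; rewrite /= -indic_cap1; ring.
Qed.

(* The probability that, after [n] distinct draws, the next [m] draws copy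
   [m] different ones of them. *)
Fixpoint copy_prob n m : R := if m is m'.+1
  then copy_prob n m' * ((n%:R - m'%:R) / (theta + (n + m')%:R)) else 1.

Lemma copy_prob_gt0 n m : (m <= n)%N -> 0 < copy_prob n m.
Proof.
elim: m => [//|m IH] mn /=; rewrite mulr_gt0 ?IH 1?ltnW//.
by rewrite divr_gt0 ?subr_gt0 ?ltr_nat// ltr_wpDr// theta_gt0.
Qed.

Lemma L2_draws n (f : n.-tuple A -> R) : L2 (law_draws X n) f -> L2 P (f \o draws n).
Proof.
by move=> f2; apply/(L2_law (@measurable_draws _ _ _ _ _ P X n)
  (fun B _ => @law_drawsE _ _ _ _ _ P X n B) f2.1).
Qed.

Lemma L2_indic_draws n (E : 'I_n -> set A) : (forall i, measurable (E i)) ->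
  L2 P (\1_(rect E) \o draws n).
Proof.
by move=> mE; apply: L2_draws; apply: L2_indic; exact: measurable_rect.
Qed.

Lemma ip_drawsZD n (E : 'I_n -> set A) a m (u v : n.-tuple A -> R) :
  (forall i, measurable (E i)) -> rect_span m u -> rect_span m v ->
  ip P (\1_(rect E) \o draws n) ((fun t => a * u t + v t) \o draws n) =
  a * ip P (\1_(rect E) \o draws n) (u \o draws n) +
  ip P (\1_(rect E) \o draws n) (v \o draws n).
Proof.
move=> mE su sv.
have E2 := L2_indic_draws mE.
rewrite !(ipC P (\1_(rect E) \o draws n)).
by rewrite -ipZD//; apply: L2_draws; [exact: (rect_span_L2 _ su)|exact: (rect_span_L2 _ sv)].
Qed.

(** [u] is the posterior mean of the monomial, characterised by its pairings with rectangles. The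
    last set [B] acts as a draw made after n + m others: it is fresh, or copies one of the n actual
    draws, or copies one of the m draws that stand for [Bs]. Only copies of actual draws can raise
    the degree, and they bring in the new factor of [copy_prob]. *)
Lemma posterior_expansion n Bs : all_measurable Bs -> exists u : n.-tuple A -> R,
  [/\ rect_span (size Bs) u,
     (forall E : 'I_n -> set A, (forall i, measurable (E i)) ->
        ip P (\1_(rect E) \o draws n) (Dprod Bs) =
        ip P (\1_(rect E) \o draws n) (u \o draws n)) &
     Dpoly (size Bs) (fun w => T u w - copy_prob n (size Bs) * Dprod Bs w)].
Proof.
elim: {Bs}(size Bs) {-2}Bs (erefl (size Bs)) => [|m IH] Bs sB mB.
  rewrite sB; exists (cst 1); split.
  - have := @rect_spanS n 0%N 1 (fun=> setT) finset.set0 (cst 0)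
      (fun=> measurableT) (fun _ _ => erefl).
    rewrite cards0 => /(_ isT (rect_span0 n 0)).
    congr rect_span; apply/funext => t; rewrite addr0 mul1r indicE mem_set//.
  - move=> E mE; congr (ip _ _ _); apply/funext => w.
    by move/size0nil : sB => ->; rewrite /Dprod big_nil.
  - rewrite [X in Dpoly _ X](_ : _ = cst 0); first exact: Dpoly0.
    apply/funext => w; move/size0nil : sB => ->.
    by rewrite /Dprod big_nil /sample_mean Rint_cst /= mulr1 subrr.
case/lastP: Bs sB mB => [//|Bs B]; rewrite size_rcons => -[sB] mBsB.
have mB : measurable B by have := mBsB (size Bs); rewrite nth_rcons ltnn eqxx.
have mBs : all_measurable Bs.
  move=> k; have := mBsB k; rewrite nth_rcons.
  by case: ltnP => // kC _; rewrite nth_default.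
have [u [su Eu pu]] := IH Bs sB mBs.
(* [v] collects the copies of the m draws that stand for [Bs]. The lists in [cap_each Bs B] have
   length m again, hence an induction on the length over all lists at once. *)
have [v [sv Ev pv]] : exists v : n.-tuple A -> R, [/\ rect_span m v,
    (forall E : 'I_n -> set A, (forall i, measurable (E i)) ->
        \sum_(Ds <- cap_each Bs B) rect_prob (rect_seq E ++ Ds) =
        ip P (\1_(rect E) \o draws n) (v \o draws n)) &
     Dpoly m.+1 (T v)].
  have : forall Ds, Ds \in cap_each Bs B -> size Ds = m /\ all_measurable Ds.
    by move=> Ds /(cap_each_measurable mB mBs); rewrite sB.
  elim: (cap_each Bs B) => [|Ds l IHl] Hl.
    exists (cst 0); split.
    - exact: rect_span0.
    - by move=> E mE; rewrite big_nil ip0r.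
    - rewrite [X in Dpoly _ X](_ : _ = cst 0); first exact: Dpoly0.
      by apply/funext => w; rewrite /sample_mean Rint_cst.
  have [|v [sv Ev pv]] := IHl.
    by move=> Es El; apply: Hl; rewrite inE El orbT.
  have [sD mD] := Hl Ds (mem_head _ _).
  have [x [sx Ex px]] := IH Ds sD mD.
  rewrite sD in sx px; exists (fun t => x t + v t); split.
  - exact: rect_spanD.
  - move=> E mE; rewrite big_cons Ev// -(ip_rect_Dprod X_polya D_limit)// Ex//.
    have := ip_drawsZD 1 mE sx sv; rewrite mul1r => <-.
    by congr (ip _ _ _); apply/funext => w; rewrite /= mul1r.
  - rewrite (funext (fun w => sample_mean_spanD w sx sv)); apply: DpolyD => //.
    rewrite [X in Dpoly _ X](_ : _ = fun w => copy_prob n m * Dprod Ds w +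
      (T x w - copy_prob n m * Dprod Ds w)); last by apply/funext => w; ring.
    apply: DpolyS => //; first by rewrite sD.
    exact: Dpoly_widen px.
rewrite sB in su pu.
pose mid t := \sum_(i < n) (\1_B (tnth t i) * u t).
have smid : rect_span m.+1 mid by apply: rect_span_sum => i; exact: rect_span_cap.
have su' : rect_span m.+1 u by exact: rect_span_widen su.
have sv' : rect_span m.+1 v by exact: rect_span_widen sv.
(* [k] normalises the urn after n + m draws, [b] is the mass of a fresh draw in [B], and [mid]
   accounts for copies of the n actual draws. *)
pose k := (theta + (n + m)%:R)^-1.
pose b := fine (alpha B).
rewrite sB; exists (fun t => k * (b * u t + (1 * mid t + v t))); split.
- exact: (rect_spanZ k (rect_spanZD b su' (rect_spanZD 1 smid sv'))).
- move=> E mE.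
  have mEs := all_measurable_rect_seq mE.
  have mEB : all_measurable (rect_seq E ++ Bs).
    by move=> j; rewrite nth_cat; case: ifP.
  rewrite (ip_rect_Dprod X_polya D_limit)// -rcons_cat rect_prob_rcons//.
  rewrite size_cat size_rect_seq sB -/k -/b cap_each_cat big_cat !big_map/=.
  rewrite (sum_cap_each_rect E B (fun Ds => rect_prob (Ds ++ Bs))) Ev//.
  have midE : ip P (\1_(rect E) \o draws n) (mid \o draws n) =
      \sum_(i < n) rect_prob (rect_seq (cap1 E i B) ++ Bs).
    rewrite ipC (_ : mid \o _ = fun w => \sum_(i < n)
      ((fun t => \1_B (tnth t i) * u t) \o draws n) w)//.
    rewrite ip_sum; [|move=> i|exact: L2_indic_draws].
      apply: eq_bigr => i _; rewrite ipC ip_rect_capped.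
      have mc := measurable_cap1 i mE mB.
      by rewrite -(ip_rect_Dprod X_polya D_limit)// Eu.
    exact: (L2_draws (rect_span_L2 (law_draws X n) (rect_span_cap i mB su))).
  rewrite -midE -(ip_rect_Dprod X_polya D_limit)// Eu//.
  have s1 := rect_spanZD 1 smid sv'.
  have s2 := rect_spanZD b su' s1.
  have := ip_drawsZD k mE s2 (rect_span0 n m.+1).
  rewrite (ip_drawsZD b mE su' s1) (ip_drawsZD 1 mE smid sv').
  rewrite [X in _ + X](_ : _ = 0) ?addr0 ?mul1r; last first.
    by rewrite ip0r.
  by move=> <-; congr (ip _ _ _); apply/funext => w; rewrite /= addr0.
- have s1 := rect_spanZD 1 smid sv'.
  have s2 := rect_spanZD b su' s1.
  have TE w : T (fun t => k * (b * u t + (1 * mid t + v t))) w =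
      k * (b * T u w + (T mid w + T v w)).
    have := sample_mean_spanZD k w s2 (rect_span0 n m.+1).
    rewrite (sample_mean_spanZD b w su' s1) (sample_mean_spanZD 1 w smid sv') mul1r.
    rewrite [X in _ + X](_ : _ = 0) ?addr0; last by rewrite /sample_mean Rint_cst.
    by move=> <-; congr (T _ _); apply/funext => t; rewrite addr0.
  have pTu : Dpoly m.+1 (T u).
    rewrite [X in Dpoly _ X](_ : _ = fun w => copy_prob n m * Dprod Bs w +
      (T u w - copy_prob n m * Dprod Bs w)); last by apply/funext => w; ring.
    apply: DpolyS => //; first by rewrite sB.
    exact: Dpoly_widen pu.
  (* Each summand has degree at most m: the top part of [T mid] cancels against (n - m) D(B) T u,
     and that of [T u] against its multiple of [Dprod Bs]. The coefficient k (n - m) left in front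
     is the last factor of [copy_prob n m.+1]. *)
  rewrite [X in Dpoly _ X](_ : _ = fun w => k * b * T u w + (k * (
      (T mid w - (n%:R - m%:R) * (Dval B w * T u w)) + T v w) +
      k * (n%:R - m%:R) * (Dval B w * (T u w - copy_prob n m * Dprod Bs w))));
    last first.
    have DE w : Dprod (rcons Bs B) w = Dprod Bs w * Dval B w.
      by rewrite /Dprod -cats1 big_cat big_seq1.
    by apply/funext => w; rewrite TE DE /= -/k; ring.
  apply: DpolyZD => //; apply: DpolyD.
    by apply: DpolyZ; apply: DpolyD => //; exact: sample_mean_span_mid.
  by apply: DpolyZ; exact: Dpoly_Dval.
Qed.

End posterior_expansion.

(** * Closed polynomial spaces and the chaos decomposition *)

Section chaos_spaces.
Context (R : realType) d (A : measurableType d)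
  (alpha : {finite_measure set A -> \bar R})
  d' (Omega : measurableType d') (P : probability Omega R)
  (X : nat -> {RV P >-> A}) (D : {RV P >-> pprobability A R}).
Hypothesis alpha_gt0 : (0 < alpha [set: A])%E.
Hypothesis X_polya : polya_sequence alpha X.
Hypothesis D_limit : empirical_limit X D.

Local Notation Dval := (Dval D).
Local Notation Dprod := (Dprod D).
Local Notation draws := (draws X).
Local Notation Dpow n w := (prob_pow n (Dprob D w)).
Local Notation T := (sample_mean D).
Local Notation Dpoly := (Dpoly D).
Local Notation copy_prob := (copy_prob alpha).

Lemma L2DE Y : L2D D Y <-> measurable_wrt (sigmaD D) Y /\ L2 P Y.
Proof.
split=> -[mY Y2]; split => //; first exact/(L2E _ (measurable_wrt_measurable mY)).
exact/(L2E _ (measurable_wrt_measurable mY)).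
Qed.

Lemma Lnorm2_lt (f : Omega -> R) (e : R) : L2 P f -> 0 < e ->
  (Lnorm P 2%:E (EFin \o f) < e%:E)%E = (ip P f f < e ^+ 2).
Proof.
move=> f2 e0.
have two0 : (2 : R) != 0 by rewrite pnatr_eq0.
have := @powR_Lnorm _ _ _ P (EFin \o f) 2 two0.
have -> : (\int[P]_x `|(EFin \o f) x| `^ 2 = (ip P f f)%:E)%E.
  rewrite /ip /Rintegral fineK; last exact: (integrable_fin_num _ (L2M f2 f2)).
  apply: eq_integral => x _ /=.
  by rewrite powR_mulrn// real_normK ?num_real// expr2.
have : (0 <= Lnorm P 2%:E (EFin \o f))%E by exact: Lnorm_ge0.
case: (Lnorm P _ _) => [r| |]//= r0; rewrite ?lee_fin in r0; last first.
  by rewrite (_ : _ == 0 = false) ?pnatr_eq0.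
move=> -[<-]; rewrite powR_mulrn// lte_fin.
by rewrite ltr_pXn2r// nnegrE ltW.
Qed.

(** [Pspace N] with squared distances measured by [ip] and with degree 0 on the same footing as the
    others; [PspaceE] identifies the two. *)
Definition Dpoly_cl N : set (Omega -> R) :=
  [set Y | L2D D Y /\ forall e : R, 0 < e ->
     exists2 Z, Dpoly N.+1 Z & ip P (fun w => Y w - Z w) (fun w => Y w - Z w) < e].

(** A power D(C)^k becomes k repetitions of [C] in the list, so the degree is the length. *)
Lemma monomials_DprodP N Z : monomials D N Z <->
  exists Bs, [/\ all_measurable Bs, (size Bs <= N)%N & Z = Dprod Bs].
Proof.
split=> [[n [C [k [mC k1 kN ->]]]]|[Bs [mB sB ->]]].
  exists (flatten [seq nseq (k j) (C j) | j <- index_enum 'I_n]); split.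
  - set Bs := flatten _ => i; have [iB|iB] := ltnP i (size Bs).
      have /flattenP[s /mapP[j _ ->]] := mem_nth setT iB.
      by rewrite mem_nseq => /andP[_ /eqP ->].
    by rewrite nth_default.
  - rewrite size_flatten /shape -map_comp sumnE big_map.
    by under eq_bigr do rewrite /= size_nseq.
  - apply/funext => w; rewrite /Dprod big_flatten big_map.
    by apply: eq_bigr => j _; rewrite big_nseq -Monoid.iteropE.
exists (size Bs), (fun j => nth setT Bs j), (fun=> 1%N); split => //.
  by rewrite sum_nat_const card_ord muln1.
by apply/funext => w; rewrite /Dprod (big_nth setT) big_mkord.
Qed.

Lemma lin_span_DpolyP N Z : lin_span (monomials D N) Z <-> Dpoly N.+1 Z.
Proof.
split=> [[m [c [F [HF ->]]]]|].
  apply: Dpoly_sum => i; have /monomials_DprodP[Bs [mB sB ->]] := HF i.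
  by apply: DpolyZ; exact: Dpoly_Dprod.
elim=> [|a Bs {}Z mB sB _ [m [c [F [HF ->]]]]].
  by exists 0%N, (fun=> 0), (fun=> cst 0); split => [[]//|]; apply/funext => w; rewrite big_ord0.
exists m.+1, (fun i => if unlift ord0 i is Some j then c j else a),
  (fun i => if unlift ord0 i is Some j then F j else Dprod Bs); split.
  move=> i; case: unliftP => [j _|_]; first exact: HF.
  by apply/monomials_DprodP; exists Bs.
apply/funext => w; rewrite big_ord_recl unlift_none; congr (_ + _).
by apply: eq_bigr => i _; rewrite liftK.
Qed.

Lemma L2D_closure_Dpoly_cl N : L2D_closure D (lin_span (monomials D N)) = Dpoly_cl N.
Proof.
have dif2 Y Z : L2D D Y -> Dpoly N.+1 Z -> L2 P (Y \- Z)%R.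
  by move=> /L2DE[_ Y2] pZ; exact: L2B Y2 (Dpoly_L2 pZ).
apply/seteqP; split=> Y [Y2 HY]; split => // e e0.
  have se0 : 0 < Num.sqrt e by rewrite sqrtr_gt0.
  have [Z /lin_span_DpolyP pZ] := HY _ se0.
  rewrite Lnorm2_lt// ?sqr_sqrtr ?(ltW e0)// => [ltZ|]; last exact: dif2.
  by exists Z.
have e20 : 0 < e ^+ 2 by rewrite exprn_gt0.
have [Z pZ ltZ] := HY _ e20.
exists Z; first exact/lin_span_DpolyP.
by rewrite Lnorm2_lt//; exact: dif2.
Qed.

Lemma Dpoly_cl_Dpoly N Z : Dpoly N.+1 Z -> Dpoly_cl N Z.
Proof.
move=> pZ; split.
  by apply/L2DE; split; [exact: Dpoly_measurable pZ|exact: Dpoly_L2 pZ].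
move=> e e0; exists Z => //; rewrite /ip.
by under eq_Rintegral do rewrite subrr mulr0; rewrite Rint_cst.
Qed.

Lemma measurable_wrtZD a (Y1 Y2 : Omega -> R) : measurable_wrt (sigmaD D) Y1 ->
  measurable_wrt (sigmaD D) Y2 -> measurable_wrt (sigmaD D) (fun w => a * Y1 w + Y2 w).
Proof.
move=> /measurable_wrt_sigmaDE m1 /measurable_wrt_sigmaDE m2.
apply/measurable_wrt_sigmaDE; apply: measurable_funD => //.
by apply: measurable_funM => //; exact: measurable_cst.
Qed.

Lemma L2D_ZD a Y1 Y2 : L2D D Y1 -> L2D D Y2 -> L2D D (fun w => a * Y1 w + Y2 w).
Proof.
move=> /L2DE[m1 l1] /L2DE[m2 l2]; apply/L2DE.
by split; [exact: measurable_wrtZD|exact: L2ZD].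
Qed.

Lemma Dpoly_cl_L2 N Y : Dpoly_cl N Y -> L2 P Y.
Proof. by move=> [/L2DE[]]. Qed.

Lemma Dpoly_cl_ZD N a Y1 Y2 : Dpoly_cl N Y1 -> Dpoly_cl N Y2 ->
  Dpoly_cl N (fun w => a * Y1 w + Y2 w).
Proof.
move=> C1 C2; have [d1 H1] := C1; have [d2 H2] := C2.
split; first exact: L2D_ZD.
move=> e e0.
have c0 : 0 < 4 * (a ^+ 2 + 1) by rewrite mulr_gt0// ltr_wpDl ?sqr_ge0.
have [Z1 p1 l1] := H1 (e / (4 * (a ^+ 2 + 1))) (divr_gt0 e0 c0).
have [Z2 p2 l2] := H2 (e / 4) (divr_gt0 e0 (ltr0n _ 4)).
exists (fun w => a * Z1 w + Z2 w); first exact: DpolyZD.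
set u := fun w => Y1 w - Z1 w in l1; set v := fun w => Y2 w - Z2 w in l2.
have u2 : L2 P u := L2B (Dpoly_cl_L2 C1) (Dpoly_L2 p1).
have v2 : L2 P v := L2B (Dpoly_cl_L2 C2) (Dpoly_L2 p2).
rewrite [X in ip P X X](_ : _ = (fun x => a * u x + v x)); last first.
  by apply/funext => x; rewrite /u /v; ring.
exact: ipZD_lt.
Qed.

Lemma Dpoly_cl_widen N N' Y : (N <= N')%N -> Dpoly_cl N Y -> Dpoly_cl N' Y.
Proof.
move=> NN [Y2 HY]; split => // e /HY[Z pZ ltZ]; exists Z => //.
by apply: Dpoly_widen pZ.
Qed.

Lemma Dpoly_cl_ae N Y Y' : Dpoly_cl N Y -> L2D D Y' ->
  {ae P, forall w, Y' w = Y w} -> Dpoly_cl N Y'.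
Proof.
move=> [Yd HY] Yd' E; split => // e /HY[Z pZ ltZ]; exists Z => //.
have /L2DE[_ Y2] := Yd; have /L2DE[_ Y2'] := Yd'.
have Z2 := Dpoly_L2 pZ.
have Eae : {ae P, forall w, Y' w - Z w = Y w - Z w} by apply: filterS E => w ->.
rewrite (eq_ae_ip _ _ _ Eae) 1?ipC ?(eq_ae_ip _ _ _ Eae)//; exact: L2B.
Qed.

(** Orthogonality passes from monomials to their span by linearity and to the closure by
    Cauchy-Schwarz. *)
Lemma Dpoly_cl_orth N Y Z : L2 P Y ->
  (forall Bs, all_measurable Bs -> (size Bs <= N)%N -> ip P Y (Dprod Bs) = 0) ->
  Dpoly_cl N Z -> ip P Y Z = 0.
Proof.
move=> Y2 HY CZ; have Z2 := Dpoly_cl_L2 CZ; have [_ HZ] := CZ.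
have Hp Q : Dpoly N.+1 Q -> ip P Y Q = 0.
  elim=> [|a Bs {}Q mB sB pQ IH].
    exact: ip0r.
  rewrite ipC ipZD//; last 2 first.
  - exact: L2_Dprod.
  - exact: Dpoly_L2 pQ.
  by rewrite ipC HY// mulr0 add0r ipC.
apply/eqP; rewrite -sqrf_eq0 eq_le sqr_ge0 andbT.
apply/ler_addgt0Pl => e e0; rewrite addr0.
(* The [+ 1] allows the division when [ip P Y Y] is 0. *)
have y0 : 0 < ip P Y Y + 1 by rewrite ltr_wpDl ?ip_ge0.
have [Q pQ ltQ] := HZ _ (divr_gt0 e0 y0).
have Q2 := Dpoly_L2 pQ.
have -> : ip P Y Z = ip P Y (fun w => Z w - Q w).
  by rewrite [RHS]ipC ipB// (ipC _ Q) (Hp Q pQ) subr0 ipC.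
apply: (le_trans (ip_CS Y2 (L2B Z2 Q2))).
apply: (@le_trans _ _ ((ip P Y Y + 1) * (e / (ip P Y Y + 1)))).
  by rewrite ler_pM ?ip_ge0 ?(ltW ltQ)// lerDl.
by rewrite mulrC divfK// gt_eqF.
Qed.

(** Such a [Y] is orthogonal to itself. Almost sure identities between elements of a closure are
    derived from this. *)
Lemma Dpoly_cl_orth_eq0 N Y : Dpoly_cl N Y ->
  (forall Bs, all_measurable Bs -> (size Bs <= N)%N -> ip P Y (Dprod Bs) = 0) ->
  {ae P, forall w, Y w = 0}.
Proof.
move=> CY HY; apply: ip_eq0_ae; first exact: Dpoly_cl_L2 CY.
exact: (Dpoly_cl_orth (Dpoly_cl_L2 CY) HY CY).
Qed.

(** Subtracting its mean makes an element of the closure orthogonal to 1, the only monomial of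
    degree 0. *)
Lemma Dpoly_cl0E : Dpoly_cl 0 = constants D.
Proof.
apply/seteqP; split => Y.
  move=> CY; have Y2 := Dpoly_cl_L2 CY; split; first exact: CY.1.
  pose c := \int[P]_w Y w; exists c.
  have p1 : Dpoly_cl 0 (cst 1).
    apply: Dpoly_cl_Dpoly; have := @Dpoly_Dprod _ _ _ _ _ _ D 1%N [::].
    move=> /(_ _ isT); rewrite (_ : Dprod [::] = cst 1).
      by apply => k; rewrite nth_nil.
    by apply/funext => w; rewrite /Dprod big_nil.
  have CY' := Dpoly_cl_ZD (- c) p1 CY.
  have : {ae P, forall w, - c * cst 1 w + Y w = 0}.
    apply: (Dpoly_cl_orth_eq0 CY') => Bs mB; rewrite leqn0 => /eqP/size0nil ->.
    rewrite /ip; under eq_Rintegral do rewrite /Dprod big_nil mulr1.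
    by rewrite Rint_ZD ?Rint_cst ?mulr1 ?addNr//; [exact: rint_cst|exact: L2_rint].
  apply: filterS => w /=; rewrite mulr1 => /eqP; rewrite addrC subr_eq0.
  by move=> /eqP.
move=> [Yd [c Yc]].
apply: (@Dpoly_cl_ae _ (cst c)) => //.
have := @Dpoly_Dprod _ _ _ _ _ _ D 1%N [::].
move=> /(_ _ isT) pD; have := Dpoly_cl_Dpoly (DpolyZ c (pD _)).
rewrite (_ : (fun w => _) = cst c); last first.
  by apply/funext => w; rewrite /Dprod big_nil mulr1.
by apply => k; rewrite nth_nil.
Qed.

Lemma PspaceE N : Pspace D N = Dpoly_cl N.
Proof. by case: N => [|N]; rewrite ?Dpoly_cl0E// -L2D_closure_Dpoly_cl. Qed.

(** Combinations of indicators of rectangles are dense and have polynomials of degree at most n as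
    sample means; the contraction property carries the approximation over. *)
Lemma Dpoly_cl_sample_mean n (g : n.-tuple A -> R) : L2 (law_draws X n) g -> Dpoly_cl n (T g).
Proof.
move=> g2.
have c1 := sample_mean_contraction X_polya D_limit.
split.
  apply/L2DE; split; last exact: (c1 _ _ g2).1.
  by apply: measurable_sample_mean; exact: g2.1.
move=> e e0.
have [s sG lt_e] := L2_dense_indic (@measurable_rectsE _ A n) (@rects_setI _ A n)
  (@rects_setT _ A n) g2 e0.
pose r (x : n.-tuple A) : R := \sum_(p <- s) p.1 * \1_(p.2) x.
have {}lt_e : ip (law_draws X n) (fun x => g x - r x) (fun x => g x - r x) < e.
  exact: lt_e.
have [r2 pr] : L2 (law_draws X n) r /\ Dpoly n.+1 (T r).
  suff sr : rect_span n r by split; [exact: rect_span_L2 sr|exact: sample_mean_span_Dpoly sr].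
  rewrite /r {r lt_e}; elim: s sG => [|p s IH] sG.
    rewrite [X in rect_span _ X](_ : _ = cst 0); first exact: rect_span0.
    by apply/funext => t; rewrite big_nil.
  rewrite [X in rect_span _ X](_ : _ =
    fun t => p.1 * \1_(p.2) t + \sum_(q <- s) q.1 * \1_(q.2) t); last first.
    by apply/funext => t; rewrite big_cons.
  have [E mE ->] := sG p (mem_head _ _).
  apply: (@rect_spanS _ _ _ n n p.1 E finset.setT) => //.
  - by move=> i; rewrite finset.in_setT.
  - by rewrite cardsT card_ord.
  - by apply: IH => q qs; apply: sG; rewrite inE qs orbT.
exists (T r) => //.
have gr2 := L2B g2 r2.
have [c2 le2] := c1 _ _ gr2.
have Eae : {ae P, forall w, T g w - T r w = T (fun t => g t - r t) w}.
  have := sample_meanZD X_polya D_limit (-1) r2 g2.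
  apply: filterS => w; rewrite mulN1r addrC => <-.
  by congr (T _ _); apply/funext => t; rewrite mulN1r addrC.
have gT := (c1 _ _ g2).1; have rT := (c1 _ _ r2).1.
have U2 := L2B gT rT.
rewrite (eq_ae_ip U2 c2 U2 Eae) ipC (eq_ae_ip U2 c2 c2 Eae).
exact: le_lt_trans le2 lt_e.
Qed.

End chaos_spaces.

(** * The sampling operator, its projections and the decomposition *)

Section chaos_decomposition.
Context (R : realType) d (A : measurableType d)
  (alpha : {finite_measure set A -> \bar R})
  d' (Omega : measurableType d') (P : probability Omega R)
  (X : nat -> {RV P >-> A}) (D : {RV P >-> pprobability A R}).
Hypothesis alpha_gt0 : (0 < alpha [set: A])%E.
Hypothesis X_polya : polya_sequence alpha X.
Hypothesis D_limit : empirical_limit X D.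

Local Notation Dval := (Dval D).
Local Notation Dprod := (Dprod D).
Local Notation draws := (draws X).
Local Notation law := (law_draws X).
Local Notation Dpow n w := (prob_pow n (Dprob D w)).
Local Notation T := (sample_mean D).
Local Notation Dpoly := (Dpoly D).
Local Notation Dpoly_cl := (Dpoly_cl D).
Local Notation copy_prob := (copy_prob alpha).

Lemma ip_draws_law n (f g : n.-tuple A -> R) : L2 (law n) f -> L2 (law n) g ->
  ip P (f \o draws n) (g \o draws n) = ip (law n) f g.
Proof.
move=> f2 g2; apply/esym.
exact: (ip_law (@measurable_draws _ _ _ _ _ P X n)
  (fun B _ => @law_drawsE _ _ _ _ _ P X n B) f2 g2).
Qed.

(** Allows a monomial to be replaced by its posterior mean, which [posterior_expansion] identifies
    on rectangles only. *)
Lemma ip_draws_ext n (Z1 Z2 : Omega -> R) : L2 P Z1 -> L2 P Z2 ->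
  (forall E : 'I_n -> set A, (forall i, measurable (E i)) ->
     ip P (\1_(rect E) \o draws n) Z1 = ip P (\1_(rect E) \o draws n) Z2) ->
  forall g, L2 (law n) g -> ip P (g \o draws n) Z1 = ip P (g \o draws n) Z2.
Proof.
move=> Z12 Z22 HE g g2.
pose H : set (n.-tuple A -> R) :=
  [set f : n.-tuple A -> R | ip P (f \o draws n) Z1 = ip P (f \o draws n) Z2].
suff : H g by [].
apply: (@functional_monotone_class _ _ R (@rects _ A n) (L2 (law n)) H) => //;
  last exact: g2.1.
- exact: measurable_rectsE.
- exact: rects_setI.
- exact: rects_setT.
- exact: L2_cst.
- by move=> v1 v2 H1 m2 H2; exact: L2_le H1 m2 H2.
- by move=> _ [E mE ->]; exact: HE.
- move=> a f1 f2 m1 m2 H1 H2; rewrite /H /mkset => E1 E2.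
  rewrite (_ : _ \o draws n = fun w => a * (f1 \o draws n) w + (f2 \o draws n) w)//.
  by rewrite !ipZD ?E1 ?E2//; exact: L2_draws.
- move=> F f mF HF mf f2 Fle Ff; rewrite /H /mkset.
  have c Z : L2 P Z -> ip P (F k \o draws n) Z @[k --> \oo] -->
            ip P (f \o draws n) Z.
    move=> ZL; apply: ip_dct => //.
    + by move=> k; exact: (L2_draws (L2_le f2 (mF k) (Fle k))).1.
    + exact: L2_draws.
    + by move=> w; exact: Ff.
    + by move=> k w; exact: Fle.
  have E : (fun k => ip P (F k \o draws n) Z1) = (fun k => ip P (F k \o draws n) Z2).
    by apply/funext => k; exact: HF.
  by have := c _ Z12; rewrite E => c1; exact: (cvg_unique _ c1 (c _ Z22)).
Qed.

(** The difference between u(X) and [T u] is orthogonal to every monomial, hence to the closure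
    containing [Y]. *)
Lemma ip_Dpoly_cl_draws n M Y (u : n.-tuple A -> R) : Dpoly_cl M Y -> L2 (law n) u ->
  ip P Y (u \o draws n) = ip P Y (T u).
Proof.
move=> CY u2; have Y2 := Dpoly_cl_L2 CY.
have Tu2 := (sample_mean_contraction X_polya D_limit u2).1.
have uX2 := L2_draws u2.
apply/eqP; rewrite -subr_eq0 !(ipC _ Y) -ipB//.
apply/eqP; apply: (Dpoly_cl_orth _ _ CY) => [|Bs mB _]; first exact: L2B.
rewrite ipB//; last exact: L2_Dprod.
by rewrite (ip_sample_mean X_polya D_limit)// subrr.
Qed.

(** [g] is E[Y | X_1, ..., X_n]. In the last clause the operator has been moved from [Y] to the
    monomial, and [q] is the remainder of lower degree in the expansion of that monomial. *)
Lemma sampling_projection n M Y : Dpoly_cl M Y -> exists g : n.-tuple A -> R,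
  [/\ L2 (law n) g,
      forall u : n.-tuple A -> R, L2 (law n) u -> ip P Y (u \o draws n) = ip (law n) g u &
      forall Bs, all_measurable Bs -> exists2 q, Dpoly (size Bs) q &
        ip P (T g) (Dprod Bs) =
        copy_prob n (size Bs) * ip P Y (Dprod Bs) + ip P Y q].
Proof.
move=> CY; have Y2 := Dpoly_cl_L2 CY.
have [g g2 Hg] := L2_cond_exp (@measurable_draws _ _ _ _ _ P X n)
  (fun B _ => @law_drawsE _ _ _ _ _ P X n B) Y2.
exists g; split => // Bs mB.
have [u [su Eu pu]] := posterior_expansion X_polya D_limit n mB.
have u2 : L2 (law n) u := rect_span_L2 _ su.
have Tu2 := (sample_mean_contraction X_polya D_limit u2).1.
exists (fun w => T u w - copy_prob n (size Bs) * Dprod Bs w) => //.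
have B2 := L2_Dprod D mB.
rewrite (ip_sample_mean X_polya D_limit)//.
rewrite (ip_draws_ext B2 (L2_draws u2) Eu)// ip_draws_law// -Hg//.
rewrite (ip_Dpoly_cl_draws CY)//.
have -> : ip P Y (fun w => T u w - copy_prob n (size Bs) * Dprod Bs w) =
    ip P Y (T u) - copy_prob n (size Bs) * ip P Y (Dprod Bs).
  rewrite ipC ipB//; last exact: L2Z.
  by congr (_ - _); rewrite ?ipZl// ipC.
by ring.
Qed.

Lemma ip_Dpoly0 i Y q : L2 P Y ->
  (forall Bs, all_measurable Bs -> (size Bs < i)%N -> ip P Y (Dprod Bs) = 0) ->
  Dpoly i q -> ip P Y q = 0.
Proof.
move=> Y2 HY; elim=> [|a Bs {}q mB sB pq IH].
  by rewrite ip0r.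
rewrite ipC ipZD//; [|exact: L2_Dprod|exact: Dpoly_L2 pq].
by rewrite ipC HY// mulr0 add0r ipC.
Qed.

(* An orthogonal projection obtained without completeness: the self-adjoint
   operator S : Y |-> E[E[Y | X_1, ..., X_n] | D] preserves [Dpoly_cl n], where it
   is triangular for the degree with positive eigenvalues [copy_prob n i], i <= n.
   So the product of the 1 - S / copy_prob n i kills [Dpoly_cl n], and its range
   is orthogonal to [Dpoly_cl n]. *)
Lemma Dpoly_cl_project n Y : Dpoly_cl n.+1 Y -> exists2 V, Dpoly_cl n V &
  forall Bs, all_measurable Bs -> (size Bs <= n)%N ->
    ip P (fun w => Y w - V w) (Dprod Bs) = 0.
Proof.
move=> CY.
suff H i : (i <= n.+1)%N -> exists2 V, Dpoly_cl n V & forall Bs, all_measurable Bs ->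
    (size Bs < i)%N -> ip P (fun w => Y w - V w) (Dprod Bs) = 0.
  by have [V CV HV] := H _ (leqnn _); exists V.
elim: i => [_|i IH iSn].
  exists (cst 0) => //; apply: Dpoly_cl_Dpoly; exact: Dpoly0.
have [V CV HV] := IH (ltnW iSn).
(* [U] is the current residual, already orthogonal to monomials of degree less than [i]. *)
pose U w := -1 * V w + Y w.
have CU : Dpoly_cl n.+1 U by apply: Dpoly_cl_ZD => //; exact: Dpoly_cl_widen (leqnSn n) CV.
have HU Bs : all_measurable Bs -> (size Bs < i)%N -> ip P U (Dprod Bs) = 0.
  move=> mB sB; rewrite -(HV _ mB sB); congr (ip _ _ _).
  by apply/funext => w; rewrite /U; ring.
have [g [g2 _ Hg]] := sampling_projection n CU.
have CTg : Dpoly_cl n (T g) by exact: (Dpoly_cl_sample_mean X_polya D_limit g2).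
pose c := copy_prob n i; have c0 : 0 < c by exact: copy_prob_gt0.
(* In degree [i] the sample mean pairs as c <U, Z>, since the remainder [q] has lower degree, so
   subtracting its multiple by c^-1 cancels that pairing; lower degrees stay orthogonal. As only n
   draws are used, [T g] lies in [Dpoly_cl n] although [U] is of degree n + 1. *)
exists (fun w => c^-1 * T g w + V w); first exact: Dpoly_cl_ZD.
move=> Bs mB; rewrite ltnS => sB.
have [q pq Eq] := Hg Bs mB.
rewrite [X in ip _ X _](_ : _ = fun w => - c^-1 * T g w + U w); last first.
  by apply/funext => w; rewrite /U; ring.
rewrite ipZD; [|exact: Dpoly_cl_L2 CTg|exact: Dpoly_cl_L2 CU|exact: L2_Dprod].
have q0 : ip P U q = 0.
  apply: (ip_Dpoly0 (Dpoly_cl_L2 CU) _ pq) => Bs' mB' sB'.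
  by apply: HU => //; exact: leq_trans sB.
rewrite Eq q0 addr0.
have [sBi|sBi] := ltnP (size Bs) i; first by rewrite HU// !mulr0 addr0.
have -> : size Bs = i by apply/eqP; rewrite eqn_leq sB.
by rewrite -/c mulrA mulNr mulVf ?gt_eqF// mulN1r addNr.
Qed.

Definition Dprod_orthogonal n Y := forall Bs, all_measurable Bs -> (size Bs <= n)%N ->
  ip P Y (Dprod Bs) = 0.

(** [T g] and c Y lie in the same closure and have equal pairings with its monomials: in degree n +
    1 the orthogonality of [Y] kills the remainder, and in lower degree both pairings vanish. *)
Lemma top_degree_sample_mean n Y : Dpoly_cl n.+1 Y -> Dprod_orthogonal n Y ->
  exists g : n.+1.-tuple A -> R, [/\ L2 (law n.+1) g,
    forall u : n.+1.-tuple A -> R, L2 (law n.+1) u ->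
      ip P Y (u \o draws n.+1) = ip (law n.+1) g u &
    {ae P, forall w, T g w = copy_prob n.+1 n.+1 * Y w}].
Proof.
move=> CY OY; have Y2 := Dpoly_cl_L2 CY.
have [g [g2 Hu Hg]] := sampling_projection n.+1 CY.
exists g; split => //.
pose c := copy_prob n.+1 n.+1.
have CTg : Dpoly_cl n.+1 (T g) by exact: (Dpoly_cl_sample_mean X_polya D_limit g2).
have CW := Dpoly_cl_ZD (- c) CY CTg.
have : {ae P, forall w, - c * Y w + T g w = 0}.
  apply: (Dpoly_cl_orth_eq0 CW) => Bs mB sB.
  rewrite ipZD//; [|exact: Dpoly_cl_L2 CTg|exact: L2_Dprod].
  have [q pq ->] := Hg Bs mB.
  rewrite (ip_Dpoly0 Y2 _ pq) ?addr0; last first.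
    by move=> Bs' mB' sB'; apply: OY => //; rewrite -ltnS (leq_trans sB').
  have [sBn|sBn] := leqP (size Bs) n; first by rewrite OY// !mulr0 addr0.
  have -> : size Bs = n.+1 by apply/eqP; rewrite eqn_leq sB.
  by rewrite -/c mulNr addNr.
by apply: filterS => w /eqP; rewrite mulNr addrC subr_eq0 => /eqP.
Qed.

(** Exchangeability is read off the mixture of product measures rather than from the urn. *)
Lemma law_perm n (s : 'S_n) B : measurable B ->
  law n B = law n (tuple_perm s @^-1` B).
Proof.
move=> mB.
have mlaw C : measurable C -> law n C = (\int[P]_w Dpow n w C)%E.
  move=> mC.
  have m1 : measurable_fun [set: n.-tuple A] (fun t => (\1_C t : R)%:E).
    by apply/measurable_EFinP; exact: measurable_indic.
  have i0 t : (0 <= (\1_C t : R)%:E)%E by rewrite lee_fin indicE.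
  have := integral_sample_mean X_polya D_limit m1 i0.
  rewrite integral_indic// setIT => <-.
  by apply: eq_integral => w _; rewrite integral_indic// setIT.
rewrite !mlaw//; last first.
  by rewrite -[X in measurable X]setTI; exact: measurable_tuple_perm.
by apply: eq_integral => w _; rewrite (prob_pow_perm s)//.
Qed.

Lemma L2_perm n (s : 'S_n) (f : n.-tuple A -> R) : L2 (law n) f ->
  L2 (law n) (f \o tuple_perm s).
Proof.
by move=> f2; apply/(L2_law (measurable_tuple_perm s) (@law_perm n s) f2.1).
Qed.

Lemma ip_perm n (s : 'S_n) (f g : n.-tuple A -> R) : L2 (law n) f -> L2 (law n) g ->
  ip (law n) f g = ip (law n) (f \o tuple_perm s) (g \o tuple_perm s).
Proof.
exact: (ip_law (measurable_tuple_perm s) (@law_perm n s)).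
Qed.

Lemma sample_mean_perm n (s : 'S_n) (g : n.-tuple A -> R) w : L2 (Dpow n w) g ->
  T (g \o tuple_perm s) w = T g w.
Proof.
move=> g2; apply/esym; rewrite /sample_mean.
exact: (Rint_law (measurable_tuple_perm s) (@prob_pow_perm _ A R n s _) (L2_rint g2)).
Qed.

Lemma L2_indic_rect n (E : 'I_n -> set A) : (forall i, measurable (E i)) ->
  L2 (law n) (\1_(rect E)).
Proof.
by move=> mE; apply: L2_indic; exact: measurable_rect.
Qed.

Lemma indic_rect_perm n (E : 'I_n -> set A) (s : 'S_n) :
  \1_(rect E) \o tuple_perm s = \1_(rect (fun i => E ((s^-1)%g i))) :> (_ -> R).
Proof.
apply/funext => t; rewrite -preimage_tuple_perm !indicE/=.
by congr (nat_of_bool _)%:R; apply/idP/idP => /set_mem H; exact: mem_set.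
Qed.

Lemma indic_rect_widen n (E : 'I_n -> set A) (E' : 'I_n.+1 -> set A) w :
  (forall i : 'I_n, E' (widen_ord (leqnSn n) i) = E i) -> E' ord_max = setT ->
  \1_(rect E) (draws n w) = \1_(rect E') (draws n.+1 w) :> R.
Proof.
move=> EE Emax; rewrite !indic_rect big_ord_recr/= Emax indicE in_setT mulr1.
by apply: eq_bigr => i _; rewrite EE !tnth_mktuple.
Qed.

(** Events of the first n draws are generated by rectangles, and these are the rectangles in n + 1
    coordinates that leave the last one free. In this form degeneracy can be combined with
    permutations of coordinates. *)
Lemma degenerateP n (h : n.+1.-tuple A -> R) : L2 (law n.+1) h ->
  is_cond_exp P (g_sigma_algebra_preimage (draws n)) (fun w => h (draws n.+1 w)) (cst 0)
  <-> forall E : 'I_n.+1 -> set A, (forall i, measurable (E i)) -> E ord_max = setT ->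
        ip (law n.+1) h (\1_(rect E)) = 0.
Proof.
move=> h2; have hX2 := L2_draws h2.
have int_set (C : set (n.-tuple A)) : measurable C ->
    (\int[P]_(w in draws n @^-1` C) (h (draws n.+1 w))%:E =
     (ip P (\1_C \o draws n) (h \o draws n.+1))%:E)%E.
  move=> mC.
  have mdC : measurable (draws n @^-1` C).
    by rewrite -[X in measurable X]setTI; exact: measurable_draws.
  have hi := L2_rint hX2.
  rewrite -[LHS]fineK; last first.
    by apply: (integrable_fin_num mdC); exact: integrableS hi.
  congr EFin.
  have -> : fine (\int[P]_(w in draws n @^-1` C) (h (draws n.+1 w))%:E)%E =
    \int[P]_(w in draws n @^-1` C) (h (draws n.+1 w)) by [].
  rewrite Rintegral_mkcond patch_indic; apply: eq_Rintegral => w _ /=.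
  by rewrite mulrC.
split=> [[_ _ H] E mE Emax|H].
  pose E' (i : 'I_n) := E (widen_ord (leqnSn n) i).
  have mE' i : measurable (E' i) by exact: mE.
  have mR := measurable_rect mE'.
  have GR : g_sigma_algebra_preimage (draws n) (draws n @^-1` rect E').
    by exists (rect E') => //; rewrite setTI.
  have := H _ GR; rewrite int_set// integral0 => -[E0].
  rewrite ipC -ip_draws_law//; last exact: L2_indic_rect.
  rewrite E0; congr (ip _ _ _).
  by apply/funext => w /=; rewrite (indic_rect_widen (E := E') w (E' := E)).
split.
- move=> B mB; rewrite preimage_cst.
  by case: ifP => _; [exists setT|exists set0] => //; rewrite setTI.
- exact: (rint_cst P 0).
- move=> _ [B mB <-]; rewrite setTI integral0 int_set//; congr EFin.
  have B2 : L2 (law n) (\1_B).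
    exact: L2_indic.
  rewrite (ip_draws_ext hX2 (L2_cst P 0) _ B2).
    by rewrite ip0r.
  move=> E mE.
  pose E' (i : 'I_n.+1) := if unlift ord_max i is Some j then E j else setT.
  have mE' i : measurable (E' i) by rewrite /E'; case: unliftP.
  have Emax : E' ord_max = setT by rewrite /E' unlift_none.
  have -> : ip P (\1_(rect E) \o draws n) (cst 0) = 0.
    by rewrite ip0r.
  have := H E' mE' Emax; rewrite ipC -ip_draws_law//; last exact: L2_indic_rect.
  move=> <-; congr (ip _ _ _); apply/funext => w /=.
  apply: indic_rect_widen => // i.
  rewrite /E' (_ : widen_ord _ i = lift ord_max i) ?liftK//.
  by apply/val_inj => /=; rewrite /bump leqNgt ltn_ord.
Qed.

Lemma Dprod_orthogonalP n Y : L2 P Y ->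
  Dprod_orthogonal n Y <-> forall Z, Dpoly_cl n Z -> Defs.orthogonal P Y Z.
Proof.
move=> Y2; split=> [OY Z CZ|H Bs mB sB].
  have Z2 := Dpoly_cl_L2 CZ; have := Dpoly_cl_orth Y2 OY CZ.
  rewrite /ip /Rintegral /Defs.orthogonal unlock => YZ0.
  by rewrite -[LHS]fineK ?YZ0// (integrable_fin_num _ (L2M Y2 Z2)).
have := H (Dprod Bs) (Dpoly_cl_Dpoly (@Dpoly_Dprod _ _ _ _ _ _ D n.+1 Bs mB sB)).
by rewrite /Defs.orthogonal unlock /ip /Rintegral => ->.
Qed.

Lemma JspaceE n Y : Jspace D n.+1 Y <-> Dpoly_cl n.+1 Y /\ Dprod_orthogonal n Y.
Proof.
rewrite /Jspace !PspaceE; split=> [[CY [_ H]]|[CY OY]].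
  by split=> //; apply/Dprod_orthogonalP => //; exact: Dpoly_cl_L2 CY.
split=> //; split; first exact: CY.1.
by apply/Dprod_orthogonalP => //; exact: Dpoly_cl_L2 CY.
Qed.

Lemma Mspace_sub_Jspace n : Mspace X D n.+1 `<=` Jspace D n.+1.
Proof.
move=> Y [Yd [h [mh sh h2 ch] Yh]]; apply/JspaceE.
have hX2 : L2 P (h \o draws n.+1).
  by apply/(L2E _) => //; apply: measurableT_comp => //; exact: measurable_draws.
have hl2 : L2 (law n.+1) h.
  by apply/(L2_law (@measurable_draws _ _ _ _ _ P X n.+1)
    (fun B _ => @law_drawsE _ _ _ _ _ P X n.+1 B) mh).
have YT : {ae P, forall w, Y w = T h w}.
  by apply: filterS Yh => w Yw; rewrite /sample_mean /Rintegral -Yw.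
have CT : Dpoly_cl n.+1 (T h) by exact: (Dpoly_cl_sample_mean X_polya D_limit hl2).
have CY : Dpoly_cl n.+1 Y by exact: (Dpoly_cl_ae CT Yd YT).
split=> // Bs mB sB; have B2 := L2_Dprod D mB.
have [u [su Eu _]] := posterior_expansion X_polya D_limit n.+1 mB.
rewrite (eq_ae_ip (Dpoly_cl_L2 CY) (Dpoly_cl_L2 CT) B2 YT) (ip_sample_mean X_polya D_limit)//.
rewrite (ip_draws_ext B2 (L2_draws (rect_span_L2 (law n.+1) su)) Eu)//.
rewrite ip_draws_law//; last exact: rect_span_L2 su.
have deg := (degenerateP hl2).1 ch.
elim: su => [|a E S {Eu}u mE ES sS su IH].
  by rewrite ip0r.
rewrite ipC ipZD//; [|exact: L2_indic_rect|exact: rect_span_L2 su].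
rewrite (ipC _ u) IH addr0.
(* At most n of the n + 1 coordinates are constrained. *)
have [i iS] : exists i, i \notin S.
  apply/existsP; rewrite -negb_forall; apply/negP => /forallP HS.
  have : (n.+1 <= #|S|)%N.
    rewrite -[X in (X <= _)%N]card_ord; apply: subset_leq_card.
    by apply/fintype.subsetP => j _; exact: HS.
  by rewrite leqNgt ltnS (leq_trans sS sB).
(* By symmetry of [h] the free coordinate can be exchanged with the last one, where degeneracy
   applies. *)
rewrite ipC (ip_perm (tperm i ord_max))//; last exact: L2_indic_rect.
rewrite (_ : h \o _ = h); last by apply/funext => t /=; exact: sh.
rewrite indic_rect_perm deg ?mulr0//.
by rewrite tpermV tpermR ES.
Qed.

(** As a conditional expectation [g] is determined only up to null sets, whereas [Xi] demands
    symmetry at every point. Averaging [g] over all permutations of the coordinates restores it and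
    almost surely keeps the sample mean. *)
Lemma Jspace_sub_Mspace n : Jspace D n.+1 `<=` Mspace X D n.+1.
Proof.
move=> Y /JspaceE[CY OY].
have [g [g2 Hu Tg]] := top_degree_sample_mean CY OY.
have c0 : 0 < copy_prob n.+1 n.+1 by exact: copy_prob_gt0.
(* One factor undoes the eigenvalue of the sampling operator, the other the number of permuted
   terms. *)
pose c := (copy_prob n.+1 n.+1 * #|'S_n.+1|%:R)^-1.
have S0 : (#|'S_n.+1|%:R : R) != 0.
  by rewrite pnatr_eq0 -lt0n; apply/card_gt0P; exists 1%g.
pose h (t : n.+1.-tuple A) : R := c * \sum_(s : 'S_n.+1) g (tuple_perm s t).
have gs2 (s : 'S_n.+1) : L2 (law n.+1) (fun t => g (tuple_perm s t)).
  exact: L2_perm.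
have h2 : L2 (law n.+1) h by apply: L2Z; exact: L2_sum.
have sh : symmetric_fun h.
  move=> s t; rewrite /h; congr (_ * _).
  rewrite [RHS](reindex_inj (mulIg s))/=; apply: eq_bigr => s' _; congr g.
  by apply: eq_from_tnth => i; rewrite !tnth_mktuple permM.
have Th : {ae P, forall w, T h w = Y w}.
  apply: filterS2 (ae_L2_Dpow X_polya D_limit g2) Tg => w gw Tgw.
  have gsi (s : 'S_n.+1) : rint (Dpow n.+1 w) (fun t => g (tuple_perm s t)).
    exact/(rint_law (measurable_tuple_perm s) (@prob_pow_perm _ A R _ s _) gw.1)/L2_rint.
  have [si Es] := Rint_sum (index_enum 'S_n.+1) gsi.
  rewrite /sample_mean /h RintegralZl// Es.
  rewrite (eq_bigr (fun=> copy_prob n.+1 n.+1 * Y w)); last first.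
    by move=> s _; rewrite -Tgw; exact: sample_mean_perm.
  rewrite sumr_const -[_ *+ _]mulr_natl /c.
  by field; rewrite S0 gt_eqF.
have [Yd _] := CY; split=> //; exists h; last first.
  apply: filterS2 (ae_L2_Dpow X_polya D_limit h2) Th => w hw <-.
  rewrite /sample_mean /Rintegral fineK//.
  exact: (integrable_fin_num measurableT (L2_rint hw)).
split => //; first exact: h2.1.
  exact: ((L2E P (L2_draws h2).1).1 (L2_draws h2)).
apply: (degenerateP h2).2 => E mE Emax.
have E2 := L2_indic_rect mE.
have -> : ip (law n.+1) h (\1_(rect E)) =
    c * \sum_(s : 'S_n.+1) ip (law n.+1) (fun t => g (tuple_perm s t)) (\1_(rect E)).
  rewrite -ip_sum// /h /ip -RintegralZl//; last by apply: L2M => //; exact: L2_sum.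
  by apply: eq_Rintegral => t _; rewrite mulrA.
rewrite big1 ?mulr0// => s _.
(* Moving [s] onto the rectangle makes the coordinate (s^-1) ord_max free. The sample mean of the
   new indicator is then a monomial of degree at most n, and [Y] is orthogonal to it. *)
pose E' i := E (s i).
have mE' i : measurable (E' i) by exact: mE.
have -> : \1_(rect E) = \1_(rect E') \o tuple_perm s :> (_ -> R).
  rewrite indic_rect_perm; congr (\1_(rect _)).
  by apply/funext => i; rewrite /E' permKV.
rewrite -[LHS](ip_perm s g2 (L2_indic_rect mE')) -Hu; last exact: L2_indic_rect.
rewrite (ip_Dpoly_cl_draws CY); last exact: L2_indic_rect.
rewrite (funext (fun w => sample_mean_rect D w mE')).
apply: (ip_Dpoly0 (i := n.+1) (Dpoly_cl_L2 CY)).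
  by move=> Bs mB sB; apply: OY.
apply: (@Dpoly_rect _ _ _ _ _ _ _ _ _ (~: [set (s^-1)%g ord_max])%SET) => //.
  by move=> i; rewrite inE negbK inE => /eqP ->; rewrite /E' permKV.
by rewrite cardsC1 card_ord.
Qed.

(** The top component is Y - V with [V] the projection of [Y] on the lower degrees, and induction
    decomposes [V]. Indexing [Z] by all natural numbers avoids changes of ordinal type. *)
Lemma Dpoly_cl_sum_Mspace N Y : Dpoly_cl N Y -> exists2 Z : nat -> Omega -> R,
  (forall l, (l <= N)%N -> Mspace X D l (Z l)) &
  {ae P, forall w, Y w = \sum_(l < N.+1) Z l w}.
Proof.
elim: N Y => [|N IH] Y CY.
  exists (fun=> Y); last by apply: aeW => w; rewrite big_ord1.
  by move=> l; rewrite leqn0 => /eqP ->; rewrite /= -Dpoly_cl0E.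
have [V CV OV] := Dpoly_cl_project CY.
have [Z ZM Ze] := IH V CV.
exists (fun l => if l == N.+1 then (fun w => Y w - V w) else Z l).
  move=> l; case: eqP => [-> _|/eqP lN lSN]; last first.
    by apply: ZM; rewrite -ltnS ltn_neqAle lN.
  apply: Jspace_sub_Mspace; apply/JspaceE; split => //.
  have := Dpoly_cl_ZD (-1) (Dpoly_cl_widen (leqnSn N) CV) CY.
  by congr (Dpoly_cl _ _); apply/funext => w; ring.
apply: filterS Ze => w Ve; rewrite big_ord_recr/= eqxx.
rewrite (eq_bigr (fun l : 'I_N.+1 => Z l w)); last first.
  by move=> l _; rewrite ltn_eqF.
by rewrite -Ve; ring.
Qed.

Lemma Mspace_sub_Dpoly_cl N : Mspace X D N `<=` Dpoly_cl N.
Proof.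
case: N => [|N] Y; first by rewrite Dpoly_cl0E.
by move=> /Mspace_sub_Jspace/JspaceE[].
Qed.

Lemma Mspace_orthogonal l m Y Z : (l < m)%N -> Mspace X D l Y -> Mspace X D m Z ->
  Defs.orthogonal P Z Y.
Proof.
case: m => [//|m] lm MY /Mspace_sub_Jspace/JspaceE[CZ OZ].
have CY := Mspace_sub_Dpoly_cl MY.
apply: (Dprod_orthogonalP m (Dpoly_cl_L2 CZ)).1 => //.
exact: Dpoly_cl_widen CY.
Qed.

Lemma chaos_decomposition N :
  Jspace D N = Mspace X D N /\ is_orthogonal_sum D N (Mspace X D) (Pspace D N).
Proof.
split; first case: N => [//|N].
  by apply/seteqP; split; [exact: Jspace_sub_Mspace|exact: Mspace_sub_Jspace].
split.
  move=> l m _ _ lm Y Z MY MZ.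
  have orthC U V : Defs.orthogonal P U V -> Defs.orthogonal P V U.
    by rewrite /Defs.orthogonal; under eq_fun do rewrite mulrC.
  have [lm'|lm'|//] := ltngtP l m.
    by apply: orthC; exact: Mspace_orthogonal lm' MY MZ.
  exact: Mspace_orthogonal lm' MZ MY.
rewrite PspaceE; apply/seteqP; split => Y.
  move=> CY; split; first exact: CY.1.
  have [Z ZM Ye] := Dpoly_cl_sum_Mspace CY.
  by exists (fun l => Z l) => // l; apply: ZM; rewrite -ltnS.
move=> [Yd [Z ZM Ye]].
apply: (Dpoly_cl_ae _ Yd Ye).
have CZ l : Dpoly_cl N (Z l).
  by apply: (Dpoly_cl_widen _ (Mspace_sub_Dpoly_cl (ZM l))); rewrite -ltnS.
elim: (index_enum 'I_N.+1) => [|l s IH].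
  rewrite [X in Dpoly_cl _ X](_ : _ = cst 0); first by apply: Dpoly_cl_Dpoly; exact: Dpoly0.
  by apply/funext => w; rewrite big_nil.
rewrite [X in Dpoly_cl _ X](_ : _ = fun w => 1 * Z l w + \sum_(i <- s) Z i w).
  exact: Dpoly_cl_ZD.
by apply/funext => w; rewrite big_cons mul1r.
Qed.

End chaos_decomposition.

Unset Implicit Arguments.

Theorem proposition5 (R : realType) (A : ptopologicalType) (polishA : polish R A)
    (alpha : {finite_measure set (borel A) -> \bar R})
    (alpha_gt0 : (0 < alpha [set: borel A])%E)
    (d : measure_display) (Omega : measurableType d) (P : probability Omega R)
    (X : nat -> {RV P >-> borel A}) (X_polya : polya_sequence alpha X)
    (D : {RV P >-> pprobability (borel A) R})
    (D_dirichlet : dirichlet_ferguson alpha D)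
    (D_limit : empirical_limit X D)
    (N : nat) :
  Jspace D N = Mspace X D N /\
  is_orthogonal_sum D N (Mspace X D) (Pspace D N).
Proof. exact: chaos_decomposition alpha_gt0 X_polya D_limit N. Qed.
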